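(* Let $\Pi$ be a translation-invariant ergodic insertion-tolerant point process on $\mathbb{R}^d$. For any $R>0$, the occupied region $\mathcal{O}(\Pi)=\bigcup_{x\in[\Pi]}B(x,R)$ has at most one unbounded cluster almost surely.
   Context: Point processes are always simple and locally finite, i.e. random elements of the space $\mathbb{M}$ of simple locally finite point measures on $\mathbb{R}^d$, equipped with the $\sigma$-field generated by the evaluations $\mu\mapsto\mu(A)$, $A$ Borel. The support of $\mu\in\mathbb{M}$ is $[\mu]=\{y:\mu(\{y\})=1\}$. A point process is translation-invariant if its law is invariant under all translations of $\mathbb{R}^d$, and ergodic if moreover every translation-invariant event has probability $0$ or $1$. For random variables $X,Y$ with values in the same measurable space, $X\prec Y$ means that $\mathbb{P}(Y\in\mathcal{A})=0$ implies $\mathbb{P}(X\in\mathcal{A})=0$ for all measurable $\mathcal{A}$. $\Pi$ is insertion-tolerant if for every Borel set $S\subseteq\mathbb{R}^d$ with Lebesgue measure in $(0,\infty)$, if $U$ is uniformly distributed on $S$ and independent of $\Pi$, then $\Pi+\delta_U\prec\Pi$, where $\delta_x$ is the point measure at $x$. $B(x,R)=\{y\in\mathbb{R}^d:\|x-y\|<R\}$ is the open Euclidean ball. The clusters are the connected components of the occupied region. *)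

(* Defs.v *)
(* MathComp-Analysis; R^n is the space 'rV[R]_n of row vectors. *)
From HB Require Import structures.
From mathcomp Require Import all_boot all_order all_algebra.
From mathcomp Require Import all_classical all_reals all_analysis.
From mathcomp Require Import measurable_realfun.

Set Implicit Arguments.
Unset Strict Implicit.
Unset Printing Implicit Defensive.

Import Order.TTheory GRing.Theory Num.Theory.
Import numFieldNormedType.Exports.

Local Open Scope classical_set_scope.
Local Open Scope ring_scope.
Local Open Scope ereal_scope.

Section borel_matrix.
Context (R : realType) (m n : nat).

(* Borel sigma-field of the library's topology on matrices, which is the
   product (= Euclidean) topology. *)
Let borel : set (set 'M[R]_(m, n)) := <<s @open 'M[R]_(m, n) >>.

Let borel0 : borel set0. Proof. exact: sigma_algebra0. Qed.

Let borelC A : borel A -> borel (~` A). Proof. exact: sigma_algebraC. Qed.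

Let borelU (F : (set 'M[R]_(m, n))^nat) :
  (forall i, borel (F i)) -> borel (\bigcup_i F i).
Proof. exact: sigma_algebra_bigcup. Qed.

HB.instance Definition _ :=
  @isMeasurable.Build (sigma_display (@open 'M[R]_(m, n))) 'M[R]_(m, n)
    borel borel0 borelC borelU.

Lemma open_measurable_mx (A : set 'M[R]_(m, n)) : open A -> measurable A.
Proof. exact: sub_sigma_algebra. Qed.

Lemma continuous_measurable_mx (f : 'M[R]_(m, n) -> 'M[R]_(m, n)) :
  continuous f -> measurable_fun setT f.
Proof.
move=> cf; apply: (measurability (@open 'M[R]_(m, n))) => //.
move=> _ [B oB <-]; rewrite setTI; apply: open_measurable_mx.
exact: (proj1 (continuousP _) cf).
Qed.

End borel_matrix.

(* Lebesgue measure on R^n, as the iterated (Tonelli) integral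
     lambda_(n+1)(A) = \int lambda_n {v | (x, v) \in A} dx;
   only its values on Borel sets are meaningful. *)
Fixpoint lebesgue_rV (R : realType) (n : nat) : set 'rV[R]_n -> \bar R :=
  match n with
  | 0%N => fun A => \d_(0%R : 'rV[R]_0) A
  | n'.+1 => fun A => \int[lebesgue_measure]_x
      @lebesgue_rV R n' [set v : 'rV[R]_n' | A (row_mx (x%:M : 'rV[R]_1) v)]
  end.

Section measures.
Context d (T : measurableType d) (R : realType).

Definition measures : Type := {measure set T -> \bar R}.

HB.instance Definition _ := gen_eqMixin measures.
HB.instance Definition _ := gen_choiceMixin measures.
HB.instance Definition _ := isPointed.Build measures mzero.

Definition measures_ev (mu : measures) (A : set T) := mu A.

Definition ev_sets : set (set measures) :=
  \bigcup_(A in measurable) preimage_set_system [set: measures] (measures_ev ^~ A) measurable.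

Let ev_measurable : set (set measures) := <<s ev_sets >>.

Let ev0 : ev_measurable set0. Proof. exact: sigma_algebra0. Qed.

Let evC A : ev_measurable A -> ev_measurable (~` A).
Proof. exact: sigma_algebraC. Qed.

Let evU (F : (set measures)^nat) :
  (forall i, ev_measurable (F i)) -> ev_measurable (\bigcup_i F i).
Proof. exact: sigma_algebra_bigcup. Qed.

HB.instance Definition _ :=
  @isMeasurable.Build (sigma_display ev_sets) measures ev_measurable ev0 evC evU.

End measures.

Section random_elements.
Context (R : realType).

(* X and Y may live on different probability spaces. *)
Definition rv_prec d d1 d2 (E : measurableType d) (T1 : measurableType d1)
    (T2 : measurableType d2) (P : probability T1 R) (Q : probability T2 R)
    (X : T1 -> E) (Y : T2 -> E) : Prop :=
  forall A : set E, measurable A -> Q (Y @^-1` A) = 0 -> P (X @^-1` A) = 0.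

Definition same_law d d1 d2 (E : measurableType d) (T1 : measurableType d1)
    (T2 : measurableType d2) (P : probability T1 R) (Q : probability T2 R)
    (X : T1 -> E) (Y : T2 -> E) : Prop :=
  forall A : set E, measurable A -> P (X @^-1` A) = Q (Y @^-1` A).

Definition independent_rv d d1 d2 (T : measurableType d)
    (E1 : measurableType d1) (E2 : measurableType d2) (P : probability T R)
    (X : T -> E1) (Y : T -> E2) : Prop :=
  forall (A : set E1) (B : set E2), measurable A -> measurable B ->
    P (X @^-1` A `&` Y @^-1` B) = P (X @^-1` A) * P (Y @^-1` B).

Definition uniform_on d (T : measurableType d) (P : probability T R) (n : nat)
    (S : set 'rV[R]_n) (U : T -> 'rV[R]_n) : Prop :=
  forall B : set 'rV[R]_n, measurable B ->
    P (U @^-1` B) = lebesgue_rV (S `&` B) / lebesgue_rV S.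

End random_elements.

Section configurations.
Context (R : realType) (n : nat).
Implicit Types (mu : measures 'rV[R]_n R) (x : 'rV[R]_n).

Definition point_measure mu : Prop :=
  exists (D : set nat) (x : nat -> 'rV[R]_n),
    forall A : set 'rV[R]_n, measurable A -> mu A = \esum_(k in D) (\d_(x k) A : \bar R).

(* For an integer-valued measure, at most 1 means 0 or 1. *)
Definition simple_measure mu : Prop := forall x, mu [set x] <= 1.

Definition locally_finite mu : Prop :=
  forall B : set 'rV[R]_n, measurable B -> bounded_set B -> mu B < +oo.

Definition configurations : set (measures 'rV[R]_n R) :=
  [set mu | [/\ point_measure mu, simple_measure mu & locally_finite mu]].

Definition mu_support mu : set 'rV[R]_n := [set y | mu [set y] = 1].

Definition add_point mu x : measures 'rV[R]_n R :=
  [the {measure set 'rV[R]_n -> \bar R} of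
    measure_add (mu : {measure set 'rV[R]_n -> \bar R}) \d_x].

End configurations.

Section translation.
Context (R : realType) (n : nat) (t : 'rV[R]_n) (mu : measures 'rV[R]_n R).

Let shift_t (x : 'rV[R]_n) : 'rV[R]_n := (x + t)%R.

Let measurable_shift_t : measurable_fun setT shift_t.
Proof.
apply: continuous_measurable_mx => x.
have ct : {for x, continuous (fun=> t : 'rV[R]_n)} by exact: cst_continuous.
have cid : {for x, continuous (fun y : 'rV[R]_n => y)} by [].
exact: (continuousD cid ct).
Qed.

Definition translate_fun : set 'rV[R]_n -> \bar R := pushforward mu shift_t.

HB.instance Definition _ := Measure.copy translate_fun
  (@measure_function_pushforward__canonical__measure_function_Measure
    _ _ _ _ R mu shift_t measurable_shift_t).

Definition translate : measures 'rV[R]_n R := translate_fun.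

End translation.

Section point_process_properties.
Context (R : realType) (n : nat).

(* The sigma-field on configurations is the trace of the one on all measures. *)
Definition point_process d (T : measurableType d) (P : probability T R)
    (Pi : {RV P >-> measures 'rV[R]_n R}) : Prop :=
  forall w, configurations (Pi w).

Definition translation_invariant d (T : measurableType d) (P : probability T R)
    (Pi : {RV P >-> measures 'rV[R]_n R}) : Prop :=
  forall t : 'rV[R]_n, same_law P P (translate t \o Pi) Pi.

Definition ergodic d (T : measurableType d) (P : probability T R)
    (Pi : {RV P >-> measures 'rV[R]_n R}) : Prop :=
  translation_invariant Pi /\
  forall A : set (measures 'rV[R]_n R), measurable A ->
    (forall t mu, configurations mu -> A (translate t mu) <-> A mu) ->
    P (Pi @^-1` A) = 0 \/ P (Pi @^-1` A) = 1.

(* Since the probability space carrying Pi may be too small to support an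
   independent U, the pair (Pi, U) is realised by a copy of Pi on an arbitrary
   probability space.  The sum Pi + delta_U is a random measure which is almost
   surely, but not surely, simple; hence \prec is stated in the space of all
   measures. *)
Definition insertion_tolerant d (T : measurableType d) (P : probability T R)
    (Pi : {RV P >-> measures 'rV[R]_n R}) : Prop :=
  forall S : set 'rV[R]_n, measurable S ->
    0 < lebesgue_rV S -> lebesgue_rV S < +oo ->
  forall (d' : measure_display) (T' : measurableType d')
    (P' : probability T' R) (Pi' : {RV P' >-> measures 'rV[R]_n R})
    (U : {RV P' >-> 'rV[R]_n}),
    point_process Pi' -> same_law P' P Pi' Pi ->
    uniform_on P' S U -> independent_rv P' Pi' U ->
    rv_prec P' P (fun w => add_point (Pi' w) (U w)) Pi.

End point_process_properties.

Section occupied_region.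
Context (R : realType) (n : nat).

(* `|v| on 'rV[R]_n is the sup norm, not the Euclidean one. *)
Definition euclidean_norm (v : 'rV[R]_n) : R :=
  Num.sqrt (\sum_(i < n) (v ord0 i ^+ 2)%R)%R.

Definition euclidean_ball (x : 'rV[R]_n) (r : R) : set 'rV[R]_n :=
  [set y | (euclidean_norm (x - y) < r)%R].

Definition occupied_region (r : R) (mu : measures 'rV[R]_n R) :
    set 'rV[R]_n :=
  \bigcup_(x in mu_support mu) euclidean_ball x r.

Definition clusters (r : R) (mu : measures 'rV[R]_n R) :
    set (set 'rV[R]_n) :=
  connected_component (occupied_region r mu) @` occupied_region r mu.

Definition unbounded_clusters (r : R) (mu : measures 'rV[R]_n R) :
    set (set 'rV[R]_n) :=
  [set C | clusters r mu C /\ ~ bounded_set C].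

End occupied_region.

(* Main.v *)
(* Burton-Keane.  Join two points of the process when their balls meet, so that
   the unbounded clusters are the unbounded components of a graph, and suppose
   that with positive probability, hence by ergodicity almost surely, there are
   two of them.  Remove the points in a large cube.  If all the unbounded
   components of the remaining configuration come close to the cube, then
   filling it with points, which by insertion tolerance preserves positive
   probability, leaves at most one unbounded component, a contradiction.
   Otherwise three components come close to some cube, and filling that cube
   creates a trifurcation with positive probability.  Then the expected number
   of trifurcations in a large cube is at least proportional to its volume.  But
   each of the three branches of a trifurcation reaches the boundary, so that
   their number is at most of the order of the surface.

   The events are measurable because adjacency is an open relation: paths of
   points correspond to paths of charged balls with rational centers. *)

(* Insertion tolerance only adds points, and it preserves positivity without any quantitative bound.
   So no point is ever deleted: the events to be filled speak of the graph outside a closed cube and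
   do not see what falls inside it. Finitely many insertions are made, so the mesh must be fixed
   before the configuration is known. Adjacency being a strict inequality, no mesh serves all
   distances below [rho]; hence nearness to the cube is graded by [slack k], that is [rho] minus the
   inverse of [k + 1], and the events carry a second index [k].

   The alternative between all components near a cube and three components near a cube holds for
   every locally finite set, so the number of unbounded components needs no case analysis.

   The final bound is separated from geometry: branches carry finite sets of labels, standing for
   small cells in a boundary layer, and different branches share no label because points with equal
   labels are adjacent. *)
From HB Require Import structures.
Require Import Defs.
From mathcomp Require Import all_boot all_order all_algebra finmap.
From mathcomp Require Import all_classical all_reals all_analysis.
From mathcomp Require Import measurable_realfun.
From mathcomp Require Import ring lra zify.

Set Implicit Arguments.
Unset Strict Implicit.
Unset Printing Implicit Defensive.

Import Order.TTheory GRing.Theory Num.Theory.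
Import numFieldNormedType.Exports.

Local Open Scope classical_set_scope.
Local Open Scope ring_scope.

(** * Branches of trifurcations *)

Section branches.
Variables (I L : finType).
Variables (H : I -> 'I_3 -> {set L}) (t : I -> 'I_3 -> I -> bool).
Implicit Types (Z : {set I}) (Y : {set L}).

(** [t z i z'] reads: branch [i] of [z] leads to [z']; [H z i] holds the labels met by that branch.
    The last clause says that a branch of [z] missing [z'] stays, as seen from [z'], on the side of
    [z]: it is part of any branch of [z'] leading to [z] and disjoint from the others. *)
Definition branch_system Z : Prop :=
  [/\ forall z i j, z \in Z -> i != j -> [disjoint H z i & H z j]%B,
      forall z i j z', z \in Z -> z' \in Z -> z != z' ->
        t z i z' -> t z j z' -> i = j &
      forall z i z' j, z \in Z -> z' \in Z -> z != z' -> ~~ t z i z' ->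
        [/\ t z' j z -> H z i \subset H z' j,
            ~~ t z' j z -> [disjoint H z i & H z' j]%B &
            forall z'', z'' \in Z -> z'' != z -> z'' != z' -> t z i z'' ->
              t z' j z'' = t z' j z]].

Lemma branch_systemS Z Z' : Z' \subset Z -> branch_system Z -> branch_system Z'.
Proof.
move=> /fintype.subsetP sZ [h1 h2 h3]; split.
- by move=> z i j /sZ; exact: h1.
- by move=> z i j z' /sZ zZ /sZ z'Z; exact: h2.
- move=> z i z' j /sZ zZ /sZ z'Z zz' ntz.
  have [a b c] := h3 z i z' j zZ z'Z zz' ntz.
  by split=> // z'' /sZ; exact: c.
Qed.

Let nb Z z i := #|[set z' in Z | (z' != z) && t z i z']|.

(** Among the branches leading somewhere, take a branch of [z] leading to the fewest elements, and
    [z'] in it. A branch of [z'] avoiding [z] leads only to elements of that branch other than [z'],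
    hence nowhere by minimality; and at most one of the three branches of [z'] leads to [z]. *)
Lemma leaf_branch Z : branch_system Z -> Z != finset.set0 ->
  exists z i j, [/\ z \in Z, i != j,
    forall z', z' \in Z -> z' != z -> ~~ t z i z' &
    forall z', z' \in Z -> z' != z -> ~~ t z j z'].
Proof.
move=> [_ h2 h3] /set0Pn[z0 z0Z].
have nb0 z i : nb Z z i = 0%N -> forall z', z' \in Z -> z' != z -> ~~ t z i z'.
  move=> /eqP; rewrite cards_eq0 => /eqP/setP e z' z'Z z'z.
  by have := e z'; rewrite !inE z'Z z'z /= => ->.
suff [z [i [j [zZ ij zi zj]]]] : exists z i j, [/\ z \in Z, i != j,
    nb Z z i = 0%N & nb Z z j = 0%N].
  by exists z, i, j; split => //; exact: nb0.
pose Q (p : I * 'I_3) := (p.1 \in Z) && (0 < nb Z p.1 p.2)%N.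
(* If no branch leads anywhere, any element will do. *)
have [/existsP[p0 p0Q]|/existsPn Q0] := boolP [exists p, Q p]; last first.
  exists z0, ord0, ord_max; split => //.
    by have := Q0 (z0, ord0); rewrite /Q z0Z -eqn0Ngt => /eqP.
  by have := Q0 (z0, ord_max); rewrite /Q z0Z -eqn0Ngt => /eqP.
case: (@arg_minnP _ p0 Q (fun p => nb Z p.1 p.2) p0Q) => -[z i] /andP[/= zZ].
rewrite card_gt0 => /set0Pn[z']; rewrite !inE => /and3P[z'Z z'z tzz'] pmin.
have zz' : z != z' by rewrite eq_sym.
have small j : ~~ t z' j z -> nb Z z' j = 0%N.
  move=> ntj; apply/eqP; rewrite -leqn0 leqNgt; apply/negP => nb_gt0.
  have := pmin (z', j); rewrite /Q /= z'Z nb_gt0 => /(_ isT).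
  apply/negP; rewrite -ltnNge; apply: proper_card; apply/fintype.properP; split.
    apply/fintype.subsetP => z''; rewrite !inE => /and3P[z''Z z''z' tz''].
    have z''z : z'' != z by apply: contraTneq tz'' => ->.
    have [_ _ /(_ z'' z''Z z''z' z''z tz'')] := h3 z' j z i z'Z zZ z'z ntj.
    by rewrite z''Z z''z tzz' => ->.
  by exists z'; rewrite !inE ?z'Z ?z'z ?eqxx ?tzz'.
have tz'1 i1 i2 : i1 != i2 -> ~~ t z' i1 z \/ ~~ t z' i2 z.
  move=> i12; have [t1|] := boolP (t z' i1 z); last by left.
  right; apply/negP => t2; move/eqP: i12; apply.
  exact: (h2 z' _ _ z z'Z zZ z'z t1 t2).
pose o1 : 'I_3 := @Ordinal 3 1 isT.
have [/small s0|/small s0] := tz'1 ord0 o1 isT.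
  have [/small s1|/small s1] := tz'1 o1 ord_max isT.
    by exists z', ord0, o1.
  by exists z', ord0, ord_max.
have [/small s1|/small s1] := tz'1 ord0 ord_max isT.
  by exists z', ord0, o1.
by exists z', o1, ord_max.
Qed.

(* Remove a leaf z' together with the labels of one of its two empty branches:
   a branch of another element that loses a label contains z', hence also the
   other empty branch of z'. *)
Lemma card_branch_system Z Y : branch_system Z ->
  (forall z i, z \in Z -> exists2 y, y \in H z i & y \in Y) -> (#|Z| <= #|Y|)%N.
Proof.
have [n] := ubnP #|Z|; elim: n Z Y => // n IHn Z Y Zn bZ hZ.
have [->|Z0] := eqVneq Z finset.set0; first by rewrite cards0.
have [z [i [j [zZ ij ti tj]]]] := leaf_branch bZ Z0.
have [h1 h2 h3] := bZ.
have [y yH yY] := hZ z i zZ.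
suff : (#|Z :\ z| <= #|Y :\: H z i|)%N.
  rewrite (cardsD1 z Z) zZ -ltnS => /leq_trans; apply.
  apply: proper_card; apply/fintype.properP; split.
    exact: finset.subsetDl.
  by exists y; rewrite // !inE yH.
apply: IHn.
- by move: Zn; rewrite (cardsD1 z Z) zZ.
- exact: branch_systemS (finset.subsetDl _ _) bZ.
move=> z' k; rewrite !inE => /andP[z'z z'Z].
have zz' : z != z' by rewrite eq_sym.
have [tk|tk] := boolP (t z' k z).
  have [/(_ tk)/fintype.subsetP sub _ _] :=
    h3 z j z' k zZ z'Z zz' (tj _ z'Z z'z).
  have [x xH xY] := hZ z j zZ; exists x; first exact: sub.
  rewrite inE xY andbT; apply/negP => xi.
  by have /pred0P/(_ x) := h1 z i j zZ ij; rewrite /= xH xi.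
have [_ /(_ tk) dis _] := h3 z i z' k zZ z'Z zz' (ti _ z'Z z'z).
have [x xH xY] := hZ z' k z'Z; exists x => //.
rewrite inE xY andbT; apply/negP => xi.
by have /pred0P/(_ x) := dis; rewrite /= xH xi.
Qed.

End branches.

(** * Norms *)

Section sup_norm.
Variables (R : realType) (n : nat).
Implicit Types (v : 'rV[R]_n) (e : R).

Lemma normr_rV_ge v i : `|v ord0 i| <= `|v|.
Proof.
rewrite [leRHS]/Num.Def.normr /= mx_normrE.
by apply/bigmax_geP; right => /=; exists (ord0, i).
Qed.

Lemma normr_rV_lt v e : 0 < e -> (forall i, `|v ord0 i| < e) -> `|v| < e.
Proof.
move=> e0 h; rewrite [ltLHS]/Num.Def.normr /= mx_normrE.
by apply/bigmax_ltP; split=> // -[i j] _ /=; rewrite (ord1 i).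
Qed.

Lemma normr_rV_gt v e : 0 <= e -> e < `|v| -> exists i, e < `|v ord0 i|.
Proof.
move=> e0 ev; apply: contrapT => /forallNP h.
suff : `|v| <= e by rewrite leNgt ev.
rewrite [leLHS]/Num.Def.normr /= mx_normrE bigmax_le// => -[i j] _ /=.
by rewrite (ord1 i) leNgt; apply/negP.
Qed.

End sup_norm.

Section euclidean_norm.
Variables (R : realType) (n : nat).
Implicit Types (u v : 'rV[R]_n) (a : R).

Let sq v : R := \sum_(i < n) v ord0 i ^+ 2.

Let sq_ge0 v : 0 <= sq v.
Proof. by apply: sumr_ge0 => i _; rewrite sqr_ge0. Qed.

Lemma euclidean_norm_ge0 v : 0 <= euclidean_norm v.
Proof. exact: sqrtr_ge0. Qed.

Lemma euclidean_norm0 : euclidean_norm (0 : 'rV[R]_n) = 0.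
Proof.
rewrite /euclidean_norm big1 ?sqrtr0// => i _.
by rewrite mxE expr0n.
Qed.

Lemma euclidean_normZ a v : euclidean_norm (a *: v) = `|a| * euclidean_norm v.
Proof.
rewrite /euclidean_norm -[LHS]/(Num.sqrt (sq (a *: v))).
have -> : sq (a *: v) = a ^+ 2 * sq v.
  by rewrite /sq mulr_sumr; apply: eq_bigr => i _; rewrite mxE exprMn.
by rewrite sqrtrM ?sqr_ge0// sqrtr_sqr.
Qed.

Lemma euclidean_normN v : euclidean_norm (- v) = euclidean_norm v.
Proof. by rewrite -scaleN1r euclidean_normZ normrN normr1 mul1r. Qed.

Lemma euclidean_distC u v : euclidean_norm (u - v) = euclidean_norm (v - u).
Proof. by rewrite -euclidean_normN opprB. Qed.

(** Cauchy-Schwarz, from Lagrange's identity, bounds the cross term. *)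
Lemma euclidean_norm_triangle u v :
  euclidean_norm (u + v) <= euclidean_norm u + euclidean_norm v.
Proof.
pose s := \sum_(i < n) u ord0 i * v ord0 i.
have cs : s ^+ 2 <= sq u * sq v.
  have : 0 <= \sum_(i < n) \sum_(j < n)
      (u ord0 i * v ord0 j - u ord0 j * v ord0 i) ^+ 2.
    by do 2![apply: sumr_ge0 => ? _]; rewrite sqr_ge0.
  have -> : \sum_(i < n) \sum_(j < n)
      (u ord0 i * v ord0 j - u ord0 j * v ord0 i) ^+ 2 =
      \sum_(i < n) \sum_(j < n) ((u ord0 i ^+ 2) * (v ord0 j ^+ 2) +
        ((v ord0 i ^+ 2) * (u ord0 j ^+ 2) -
         2 * (u ord0 i * v ord0 i) * (u ord0 j * v ord0 j))).
    by apply: eq_bigr => i _; apply: eq_bigr => j _; ring.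
  have -> : \sum_(i < n) \sum_(j < n) ((u ord0 i ^+ 2) * (v ord0 j ^+ 2) +
        ((v ord0 i ^+ 2) * (u ord0 j ^+ 2) -
         2 * (u ord0 i * v ord0 i) * (u ord0 j * v ord0 j))) =
      sq u * sq v + (sq v * sq u - 2 * s * s).
    rewrite /sq /s -mulrA !mulr_suml mulr_sumr -sumrB -big_split /=.
    apply: eq_bigr => i _; rewrite !mulr_sumr -sumrB -big_split /=.
    by apply: eq_bigr => j _; rewrite !mulrA.
  by move: (sq u) (sq v) => a b; rewrite expr2; nra.
have -> : euclidean_norm (u + v) = Num.sqrt (sq u + sq v + 2 * s).
  rewrite /euclidean_norm; congr Num.sqrt.
  rewrite /sq /s mulr_sumr -!big_split /=; apply: eq_bigr => i _.
  by rewrite mxE; ring.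
rewrite -(@ler_pXn2r _ 2) ?nnegrE ?addr_ge0 ?sqrtr_ge0//.
have uvE : (euclidean_norm u + euclidean_norm v) ^+ 2 =
    sq u + sq v + 2 * (Num.sqrt (sq u) * Num.sqrt (sq v)).
  rewrite sqrrD !sqr_sqrtr ?sq_ge0// -/(sq u) -/(sq v) mulr2n.
  rewrite -/(Num.sqrt (sq u)) /euclidean_norm -/(sq u) -/(sq v); ring.
have sle : s <= Num.sqrt (sq u) * Num.sqrt (sq v).
  rewrite -sqrtrM ?sq_ge0//; apply: le_trans (ler_norm s) _.
  by rewrite -sqrtr_sqr ler_wsqrtr.
have s0 : 0 <= sq u + sq v + 2 * s.
  suff -> : sq u + sq v + 2 * s = sq (u + v) by exact: sq_ge0.
  rewrite /sq /s mulr_sumr -!big_split /=; apply: eq_bigr => i _.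
  by rewrite mxE; ring.
rewrite uvE sqr_sqrtr// lerD2l; lra.
Qed.

Lemma euclidean_dist_triangle w u v :
  euclidean_norm (u - v) <= euclidean_norm (u - w) + euclidean_norm (w - v).
Proof.
by rewrite -[u - v](subrKA w) euclidean_norm_triangle.
Qed.

Lemma normr_le_euclidean_norm v : `|v| <= euclidean_norm v.
Proof.
rewrite [leLHS]/Num.Def.normr /= mx_normrE.
rewrite bigmax_le ?sqrtr_ge0// => -[i j] _ /=.
rewrite (ord1 i) -sqrtr_sqr ler_wsqrtr// (bigD1 j)//= lerDl.
by apply: sumr_ge0 => k _; rewrite sqr_ge0.
Qed.

(** The crude factor [n.+1] is positive in every dimension, so that later bounds can divide by
    it. *)
Lemma euclidean_norm_le v : euclidean_norm v <= n.+1%:R * `|v|.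
Proof.
have h : 0 <= n.+1%:R * `|v| by rewrite mulr_ge0.
rewrite -[leRHS]ger0_norm// -sqrtr_sqr ler_wsqrtr//.
apply: (@le_trans _ _ (\sum_(i < n) `|v| ^+ 2)).
  apply: ler_sum => i _; rewrite -[v ord0 i ^+ 2]real_normK ?num_real//.
  by rewrite lerXn2r ?nnegrE ?normr_rV_ge.
rewrite sumr_const card_ord -[_ *+ n]mulr_natl exprMn ler_wpM2r ?sqr_ge0//.
rewrite -natrX ler_nat expnS expn1; nia.
Qed.

End euclidean_norm.

(** * Connectivity inside a set of points *)

Section reach.
Variables (V : Type) (e : V -> V -> Prop).
Implicit Types (X Y B : set V) (x y z : V).

Inductive reach X x : V -> Prop :=
| reach_refl : X x -> reach X x x
| reach_step y z : reach X x y -> X z -> e y z -> reach X x z.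

Lemma reachr X x y : reach X x y -> X y.
Proof. by case. Qed.

Lemma reachl X x y : reach X x y -> X x.
Proof. by elim. Qed.

Lemma reach1 X x y : X x -> X y -> e x y -> reach X x y.
Proof. by move=> Xx; apply: reach_step; exact: reach_refl. Qed.

Lemma reach_trans X x y z : reach X x y -> reach X y z -> reach X x z.
Proof.
move=> xy; elim=> // z1 z2 _ xz1 Xz2 ez; exact: reach_step xz1 Xz2 ez.
Qed.

(** Only the component of [x] has to lie in [Y]: this serves when that component, but not all of
    [X], avoids a cube. *)
Lemma reach_sub X Y x y : (forall z, reach X x z -> Y z) -> reach X x y ->
  reach Y x y.
Proof.
move=> h; elim=> [Xx|y1 y2 r1 IH Xy2 ey]; first exact/reach_refl/h/reach_refl.
by apply: (reach_step IH _ ey); apply: h; exact: reach_step r1 Xy2 ey.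
Qed.

Lemma reachS X Y x y : X `<=` Y -> reach X x y -> reach Y x y.
Proof. by move=> sXY; apply: reach_sub => z /reachr /sXY. Qed.

(** The path is cut at its last visit to [B]. *)
Lemma reach_exit X B x z : reach X x z -> B x -> B z \/
  exists y w, [/\ X y, B y, e y w & reach (X `\` B) w z].
Proof.
move=> r Bx; elim: r => [_|z1 z2 r1 IH Xz2 ez]; first by left.
have [Bz2|nBz2] := pselect (B z2); [by left|right].
case: IH => [Bz1|[y [w [Xy By eyw rw]]]].
  by exists z1, z2; split=> //; [exact: reachr r1|exact: reach_refl].
by exists y, w; split=> //; exact: reach_step rw _ ez.
Qed.

Hypothesis e_sym : forall x y, e x y -> e y x.

Lemma reach_sym X x y : reach X x y -> reach X y x.
Proof.
elim=> [|y1 y2 r1 IH Xy2 ey]; first exact: reach_refl.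
apply: reach_trans IH; apply: reach1 => //; last exact: e_sym.
exact: reachr r1.
Qed.

End reach.

Lemma reach_map (V W : Type) (e : V -> V -> Prop) (e' : W -> W -> Prop)
    (f : V -> W) (X : set V) (Y : set W) x y :
  (forall z, X z -> Y (f z)) -> (forall u v, e u v -> e' (f u) (f v)) ->
  reach e X x y -> reach e' Y (f x) (f y).
Proof.
move=> XY ee'; elim=> [Xx|y1 y2 _ IH Xy2 ey]; first exact/reach_refl/XY.
by apply: (reach_step IH); [exact: XY|exact: ee'].
Qed.

Lemma finite_set_exists_nat (T : Type) (F : set T) (P : T -> nat -> Prop) :
  finite_set F -> (forall x k l, (k <= l)%N -> P x k -> P x l) ->
  (forall x, F x -> exists k, P x k) -> exists k, forall x, F x -> P x k.
Proof.
move=> finF Pm Pex.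
have [f fP] : {f : T -> nat & forall x, F x -> P x (f x)}.
  apply: (@choice _ _ (fun x k => F x -> P x k)) => x.
  by have [/Pex[k Pk]|nFx] := pselect (F x); [exists k|exists 0%N].
have /finite_seqP[s sE] : finite_set (f @` F) by exact: finite_image.
exists (\max_(i <- s) i)%N => x Fx; apply: Pm (fP x Fx).
apply: leq_bigmax_seq => //.
have : (f @` F) (f x) by exists x.
by rewrite sE.
Qed.

Section unbounded_reach.
Variables (R : realType) (V : normedModType R) (e : V -> V -> Prop).
Hypothesis e_sym : forall x y, e x y -> e y x.
Implicit Types (X Y B : set V) (x y z : V).

Definition unbounded_reach X x : Prop :=
  X x /\ forall j : nat, exists2 y, reach e X x y & j%:R < `|y|.

Lemma unbounded_reach_reach X x y :
  reach e X x y -> unbounded_reach X x -> unbounded_reach X y.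
Proof.
move=> xy [Xx h]; split=> [|j]; first exact: reachr xy.
have [z xz jz] := h j; exists z => //.
exact: reach_trans (reach_sym e_sym xy) xz.
Qed.

Lemma unbounded_reach_sub X Y x : (forall z, reach e X x z -> Y z) ->
  unbounded_reach X x -> unbounded_reach Y x.
Proof.
move=> h [Xx un]; split=> [|j]; first exact/h/reach_refl.
by have [y xy jy] := un j; exists y => //; exact: reach_sub xy.
Qed.

Lemma unbounded_reachS X Y x : X `<=` Y ->
  unbounded_reach X x -> unbounded_reach Y x.
Proof.
move=> sXY; apply: unbounded_reach_sub => z xz; apply: sXY; exact: reachr xz.
Qed.

Variable rho : R.
Hypothesis e_range : forall x y, e x y -> `|x - y| < rho.

(** Removing a cube cannot break an unbounded component into bounded pieces only: each piece met by
    a path leaving the cube starts at one of the finitely many points within [rho] of it. *)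
Lemma unbounded_reach_exit X (m : R) p q :
  (forall b : R, finite_set (X `&` [set x | `|x| <= b])) ->
  unbounded_reach X p -> reach e X p q -> `|q| <= m ->
  exists w y, [/\ unbounded_reach (X `\` [set x | `|x| <= m]) w,
    X y, `|y| <= m, e w y & reach e X p w].
Proof.
move=> Xfin Xp pq qm; set B := [set x | `|x| <= m].
pose F := [set w | [/\ X w, `|w| <= m + rho, ~ B w,
  reach e X p w & exists y, [/\ X y, B y & e w y]]].
have finF : finite_set F.
  by apply: sub_finite_set (Xfin (m + rho)) => w [].
have [w Fw uw] : exists2 w, F w & unbounded_reach (X `\` B) w.
  apply: contrapT => /forall2NP noF.
  have [k kP] : exists k : nat, forall w, F w ->
      forall y, reach e (X `\` B) w y -> `|y| <= k%:R.
    apply: finite_set_exists_nat => // [w k l kl h y /h/le_trans|w Fw].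
      by apply; rewrite ler_nat.
    have [//|nu] := noF w.
    apply: contrapT => /forallNP nk; apply: nu; split=> [|j].
      by case: Fw.
    have /existsNP[y /not_implyP[wy /negP]] := nk j.
    by rewrite -ltNge => jy; exists y.
  (* A point of norm beyond [j] is neither in the cube nor, by the choice of [k], reachable from [F]
     outside it. *)
  pose j := (Num.truncn m + k).+1.
  have [_ /(_ j)[z pz jz]] := Xp.
  have mj : m < j%:R.
    rewrite (lt_le_trans (truncnS_gt m))// ler_nat /j ltnS leq_addr//.
  have qz := reach_trans (reach_sym e_sym pq) pz.
  have [Bz|[y [w [Xy By eyw wz]]]] := @reach_exit _ _ _ B _ _ qz qm.
    by move: jz; rewrite ltNge (le_trans Bz)// ltW.
  have [Xw nBw] := reachl wz.
  have Fw : F w.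
    split=> //.
    - rewrite -[w](subrK y) addrC (le_trans (ler_normD _ _))// lerD//.
      by rewrite ltW// e_range//; exact: e_sym.
    - apply: reach_trans pz _; apply: reach_sym => //.
      by apply: reachS wz; exact: subDsetl.
    - by exists y; split=> //; exact: e_sym.
  have := kP w Fw z wz; rewrite leNgt => /negP; apply; apply: le_lt_trans jz.
  by rewrite ler_nat; exact: leq_trans (leq_addl _ _) (leqnSn _).
case: Fw => Xw _ _ pw [y [Xy By ewy]].
by exists w, y; split.
Qed.

End unbounded_reach.

Lemma unbounded_reach_shift (R : realType) (V : normedModType R)
    (e : V -> V -> Prop) (X Y : set V) (t x : V) :
  (forall z, X z -> Y (z + t)) -> (forall u v, e u v -> e (u + t) (v + t)) ->
  unbounded_reach e X x -> unbounded_reach e Y (x + t).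
Proof.
move=> XY et [Xx h]; split=> [|j]; first exact: XY.
have [y xy jy] := h (j + (Num.truncn `|t|).+1)%N.
exists (y + t); first exact: (reach_map XY et xy).
rewrite -(ltrD2r `|t|); apply: (@lt_le_trans _ _ `|y|).
  apply: lt_trans jy; rewrite natrD ltrD2l; exact: truncnS_gt.
by rewrite -{1}[y](addrK t) -[X in _ <= _ + X]normrN ler_normD.
Qed.

(** * The graph of a configuration *)

Section adjacency.
Variables (R : realType) (n : nat) (rho : R).
Local Notation V := 'rV[R]_n.
Implicit Types (X : set V) (x y z : V).

(** Equivalently, the open balls of radius [rho / 2] around [x] and [y] meet. *)
Definition adj x y : Prop := euclidean_norm (x - y) < rho.

Lemma adj_sym x y : adj x y -> adj y x.
Proof. by rewrite /adj euclidean_distC. Qed.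

Lemma adj_shift t x y : adj x y -> adj (x + t) (y + t).
Proof. by rewrite /adj opprD addrACA subrr addr0. Qed.

Lemma adj_range x y : adj x y -> `|x - y| < rho.
Proof. exact/le_lt_trans/normr_le_euclidean_norm. Qed.

Lemma adj_near x y : `|x - y| < rho / n.+1%:R -> adj x y.
Proof.
rewrite ltr_pdivlMr// => xy; apply: le_lt_trans (euclidean_norm_le _) _.
by rewrite mulrC.
Qed.

Definition two_unbounded X : Prop := exists x y,
  [/\ unbounded_reach adj X x, unbounded_reach adj X y & ~ reach adj X x y].

Lemma two_unbounded_shift X Y t : (forall z, X z -> Y (z + t)) ->
  (forall z, Y z -> X (z - t)) -> two_unbounded X -> two_unbounded Y.
Proof.
move=> XY YX [x [y [ux uy nxy]]]; exists (x + t), (y + t).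
have at' := @adj_shift t; have at'' := @adj_shift (- t).
split; [exact: unbounded_reach_shift ux|exact: unbounded_reach_shift uy|].
by move=> /(reach_map YX at''); rewrite !addrK.
Qed.

Definition dense_in X (m eta : R) : Prop :=
  forall y : V, `|y| <= m -> exists p, [/\ X p, `|p| <= m & `|p - y| < eta].

(** Walk along the segment, which stays in the convex cube, in steps shorter than [eta], and shadow
    each position by a point of [X] within [eta]. Consecutive shadows are less than [3 * eta]
    apart. *)
Lemma dense_in_reach X (m eta : R) x y :
  dense_in X m eta -> 4 * eta <= rho / n.+1%:R ->
  X x -> X y -> `|x| <= m -> `|y| <= m ->
  reach adj (X `&` [set z | `|z| <= m]) x y.
Proof.
move=> Xd eta_le Xx Xy xm ym.
have m0 : 0 <= m by exact: le_trans xm.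
have eta0 : 0 < eta.
  have [|p [_ _]] := Xd 0; first by rewrite normr0.
  exact: le_lt_trans.
pose N := (Num.truncn (`|y - x| / eta)).+1.
have N0 : 0 < N%:R :> R by rewrite ltr0n.
have stepN : `|y - x| / N%:R < eta.
  by rewrite ltr_pdivrMr// mulrC -ltr_pdivrMr// truncnS_gt.
pose w (j : nat) : V := x + (j%:R / N%:R) *: (y - x).
have wm j : (j <= N)%N -> `|w j| <= m.
  move=> jN; have -> : w j = (1 - j%:R / N%:R) *: x + (j%:R / N%:R) *: y.
    by apply/rowP => i; rewrite !mxE; ring.
  have j1 : j%:R / N%:R <= 1 :> R by rewrite ler_pdivrMr// mul1r ler_nat.
  have j0 : 0 <= j%:R / N%:R :> R by rewrite divr_ge0.
  apply: le_trans (ler_normD _ _) _; rewrite 2!normrZ.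
  rewrite (ger0_norm j0) ger0_norm ?subr_ge0//.
  have -> : m = (1 - j%:R / N%:R) * m + (j%:R / N%:R) * m.
    by rewrite -mulrDl subrK mul1r.
  by rewrite lerD// ler_wpM2l// subr_ge0.
have wS j : `|w j - w j.+1| < eta.
  have -> : w j - w j.+1 = - (N%:R^-1 *: (y - x)).
    by apply/rowP => i; rewrite !mxE -natr1; ring.
  by rewrite normrN normrZ ger0_norm ?invr_ge0 ?ler0n// mulrC.
have hw j : (j <= N)%N -> exists p, `|p - w j| < eta /\
    reach adj (X `&` [set z | `|z| <= m]) x p.
  elim: j => [_|j IH jN].
    exists x; rewrite /w mul0r scale0r addr0 subrr normr0; split=> //.
    exact: reach_refl.
  have [p [pw xp]] := IH (ltnW jN).
  have [q [Xq qm qw]] := Xd _ (wm _ jN).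
  exists q; split=> //; apply: reach_step xp _ _ => //.
  apply: adj_near; apply: lt_le_trans eta_le.
  have -> : p - q = (p - w j) + (w j - w j.+1) + (w j.+1 - q).
    by apply/rowP => i; rewrite !mxE; ring.
  apply: le_lt_trans (ler_normD _ _) _.
  apply: le_lt_trans (lerD (ler_normD _ _) (lexx _)) _.
  move: (wS j); rewrite (distrC (w j.+1)); lra.
have [p [pw xp]] := hw N (leqnn N).
apply: reach_step xp _ _ => //; apply: adj_near.
apply: lt_le_trans eta_le.
by move: pw; rewrite /w divff ?gt_eqF// scale1r (addrC x) subrK; lra.
Qed.

Definition near_cball (m s : R) : set V :=
  [set x | exists2 y, `|y| <= m & euclidean_norm (x - y) < s].

Lemma near_cballS m s s' : s <= s' -> near_cball m s `<=` near_cball m s'.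
Proof. by move=> ss x [y ym xy]; exists y => //; exact: lt_le_trans ss. Qed.

(** Replacing a point of the cube by a point of [X] costs at most [n.+1 * eta] in Euclidean
    distance. *)
Lemma near_cball_adj X m s eta x : dense_in X m eta ->
  s + n.+1%:R * eta <= rho -> near_cball m s x ->
  exists p, [/\ X p, `|p| <= m & adj x p].
Proof.
move=> Xd seta [y ym xy]; have [p [Xp pm py]] := Xd _ ym.
exists p; split=> //; rewrite /adj.
apply: le_lt_trans (euclidean_dist_triangle y _ _) _.
apply: lt_le_trans seta; rewrite ltr_leD//.
apply: le_trans (euclidean_norm_le _) _.
by rewrite ler_wpM2l// distrC ltW.
Qed.

Local Notation cball m := [set x : V | `|x| <= m].

Definition all_near X (m s : R) : Prop :=
  forall x, unbounded_reach adj (X `\` cball m) x ->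
  exists2 y, reach adj (X `\` cball m) x y & near_cball m s y.

Definition three_near X (m s : R) : Prop := exists c : 'I_3 -> V,
  (forall i, unbounded_reach adj (X `\` cball m) (c i) /\
    exists2 y, reach adj (X `\` cball m) (c i) y & near_cball m s y) /\
  (forall i j, i != j -> ~ reach adj (X `\` cball m) (c i) (c j)).

(** An unbounded component missing the cube would survive its removal, hence come near it and be
    adjacent to one of the dense points inside. So all unbounded components meet the cube, whose
    points are joined to each other. *)
Lemma all_near_dense X m s eta : 0 <= m -> all_near X m s -> dense_in X m eta ->
  4 * eta <= rho / n.+1%:R -> s + n.+1%:R * eta <= rho -> ~ two_unbounded X.
Proof.
move=> m0 Xall Xd eta1 eta2 [x [y [ux uy]]]; apply.
have hit z : unbounded_reach adj X z ->
    exists2 q, reach adj X z q & `|q| <= m.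
  move=> uz; apply: contrapT => /forall2NP nhit.
  have uz' : unbounded_reach adj (X `\` cball m) z.
    apply: unbounded_reach_sub uz => w zw; split; first exact: reachr zw.
    by have [] := nhit w.
  have [w zw nw] := Xall _ uz'.
  have [p [Xp pm wp]] := near_cball_adj Xd eta2 nw.
  have [|//] := nhit p; apply.
  by apply: reach_step wp => //; apply: reachS zw; exact: subDsetl.
have [p xp pm] := hit x ux; have [q yq qm] := hit y uy.
apply: (reach_trans xp); apply: reach_trans (reach_sym adj_sym yq).
apply: (@reachS _ _ (X `&` cball m)); first exact: subIsetl.
by apply: (dense_in_reach Xd eta1) => //; [exact: reachr xp|exact: reachr yq].
Qed.

(** Increases to [rho]; the difference is the room left for the mesh. *)
Definition slack (k : nat) : R := rho - k.+1%:R^-1.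

Lemma slackS k l : (k <= l)%N -> slack k <= slack l.
Proof.
by move=> kl; rewrite lerB// lef_pV2 ?posrE// ler_nat ltnS.
Qed.

Lemma slackP a : a < rho -> exists k, a < slack k.
Proof.
rewrite -subr_gt0 => ar; exists (Num.truncn (rho - a)^-1).
rewrite /slack ltrBrDr -ltrBrDl -[ltRHS]invrK ltf_pV2 ?posrE ?invr_gt0//.
exact: truncnS_gt.
Qed.

Lemma all_or_three_near X :
  (forall b : R, finite_set (X `&` [set x | `|x| <= b])) ->
  exists m k : nat,
    all_near X m.+1%:R (slack k) \/ three_near X m.+1%:R (slack k).
Proof.
move=> Xfin.
pose hits (m : nat) x := exists2 q, reach adj X x q & `|q| <= m.+1%:R.
(* Either one cube meets all unbounded components, or every cube is missed by some. In the first
   case components leave the cube through finitely many points, so one [k] suits all. *)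
have [[m hm]|/forallNP nom] :=
    pselect (exists m, forall x, unbounded_reach adj X x -> hits m x).
  pose F := [set w | [/\ X w, `|w| <= m.+1%:R + rho &
    exists y, [/\ X y, `|y| <= m.+1%:R & adj y w]]].
  have finF : finite_set F.
    by apply: sub_finite_set (Xfin (m.+1%:R + rho)) => w [].
  have [k kP] : exists k, forall w, F w -> near_cball m.+1%:R (slack k) w.
    apply: finite_set_exists_nat => //.
      by move=> x k l /slackS/near_cballS; exact.
    move=> w [_ _ [y [_ ym /adj_sym/slackP[k wy]]]].
    by exists k, y.
  exists m, k; left => x ux.
  have uX : unbounded_reach adj X x.
    by apply: unbounded_reachS ux; exact: subDsetl.
  have [q xq qm] := hm x uX.
  have [[Xx nx] _] := ux.
  have [//|[y [w [Xy ym yw wx]]]] :=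
    @reach_exit _ _ _ (cball m.+1%:R) _ _ (reach_sym adj_sym xq) qm.
  exists w; first exact: (reach_sym adj_sym).
  apply: kP; split; first by have [] := reachl wx.
    rewrite -[w](subrK y) addrC (le_trans (ler_normD _ _))// lerD//.
    by rewrite ltW// adj_range//; exact: adj_sym.
  by exists y.
have get k : exists y, unbounded_reach adj X y /\ ~ hits k y.
  have /existsNP[y /not_implyP[uy ny]] := nom k.
  by exists y.
pose up (y : V) := (Num.truncn `|y|).+1.
have upP y k : (up y <= k)%N -> `|y| <= k.+1%:R.
  by move=> yk; rewrite ltW// (lt_le_trans (truncnS_gt _))// ler_nat leqW.
(* Each new component misses a cube containing the earlier starting points, so the three components
   are distinct. *)
have [x1 [u1 _]] := get 0%N.
have [x2 [u2 n2]] := get (up x1).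
have [x3 [u3 n3]] := get (up x1 + up x2)%N.
pose m := (up x1 + up x2 + up x3)%N.
pose x (i : 'I_3) := if val i is 0 then x1 else if val i is 1 then x2 else x3.
have xu i : unbounded_reach adj X (x i) by case: i => -[|[|[|]]].
have xm i : `|x i| <= m.+1%:R.
  by apply: upP; rewrite /m; case: i => -[|[|[|//]]] ?; rewrite /x /=; lia.
have nx i j : i != j -> ~ reach adj X (x i) (x j).
  have n12 : ~ reach adj X x2 x1.
    by move=> r; apply: n2; exists x1 => //; exact: upP.
  have n13 : ~ reach adj X x3 x1.
    by move=> r; apply: n3; exists x1 => //; apply: upP; lia.
  have n23 : ~ reach adj X x3 x2.
    by move=> r; apply: n3; exists x2 => //; apply: upP; lia.
  by case: i j => -[|[|[|//]]] ? [[|[|[|//]]] ?] //= _;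
    rewrite /x /=; first [assumption | move=> /(reach_sym adj_sym); assumption].
(* The removal of a cube containing all three starting points leaves, in each component, an
   unbounded piece attached to that cube. *)
have xe i : exists w, exists y, [/\ unbounded_reach adj (X `\` cball m.+1%:R) w,
    X y, `|y| <= m.+1%:R, adj w y & reach adj X (x i) w].
  have xx : reach adj X (x i) (x i) by apply: reach_refl; case: (xu i).
  exact: (unbounded_reach_exit adj_sym adj_range Xfin (xu i) xx (xm i)).
have [c cP] := choice xe.
have [k kP] : exists k, forall i, near_cball m.+1%:R (slack k) (c i).
  have [//|i k l kl|i _|k kP] := @finite_set_exists_nat _ [set: 'I_3]
      (fun i k => near_cball m.+1%:R (slack k) (c i)).
  - by apply: near_cballS; exact: slackS.
  - have [y [_ Xy ym /slackP[k wy] _]] := cP i.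
    by exists k, y.
  - by exists k => i; exact: kP.
exists m, k; right; exists c; split.
  move=> i; have [y [ui _ _ _ _]] := cP i; split=> //.
  by exists (c i) => //; apply: reach_refl; case: ui.
move=> i j ij r; apply: (nx i j ij).
have [yi [_ _ _ _ ri]] := cP i; have [yj [_ _ _ _ rj]] := cP j.
apply: (reach_trans ri); apply: reach_trans (reach_sym adj_sym rj).
by apply: reachS r; exact: subDsetl.
Qed.

Local Notation cballc z m := [set x : V | `|x - z| <= m].

(** A whole cube plays the part of a vertex whose removal splits its component: its points are
    joined inside it, and [b] represents them. *)
Definition trifurcation X z (m : R) : Prop := exists (b : V) (c : 'I_3 -> V),
  [/\ X b /\ `|b - z| <= m,
      forall x, X x -> `|x - z| <= m -> reach adj (X `&` cballc z m) b x,
      forall i, unbounded_reach adj (X `\` cballc z m) (c i) /\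
        exists y, [/\ X y, `|y - z| <= m & adj (c i) y] &
      forall i j, i != j -> ~ reach adj (X `\` cballc z m) (c i) (c j)].

(** [Y] is [X] recentered at [z], the form in which translated configurations provide it. *)
Lemma three_near_trifurcation X Y z m s eta : 0 <= m ->
  (forall x, Y x <-> X (x + z)) -> three_near Y m s -> dense_in Y m eta ->
  4 * eta <= rho / n.+1%:R -> s + n.+1%:R * eta <= rho -> trifurcation X z m.
Proof.
move=> m0 YX [c [cP cN]] Yd eta1 eta2.
have [b [Yb bm _]] : exists p, [/\ Y p, `|p| <= m & `|p - 0| < eta].
  by apply: Yd; rewrite normr0.
(* In each component pass to a representative close enough to be adjacent to the filled cube. *)
have /choice[d dP] : forall i, exists y,
    reach adj (Y `\` cball m) (c i) y /\ near_cball m s y.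
  by move=> i; have [_ [y]] := cP i; exists y.
have YXD x : (Y `\` cball m) x -> (X `\` cballc z m) (x + z).
  by move=> [/YX Xx xm]; split=> //=; rewrite addrK.
have XYD x : (X `\` cballc z m) x -> (Y `\` cball m) (x - z).
  by move=> [Xx xm]; split=> //; apply/YX; rewrite subrK.
exists (b + z), (fun i => d i + z); split.
- by rewrite addrK; split=> //; apply/YX.
- move=> x Xx xz.
  have Yx : Y (x - z) by apply/YX; rewrite subrK.
  rewrite -[x](subrK z).
  have YXI w : (Y `&` cball m) w -> (X `&` cballc z m) (w + z).
    by move=> [/YX Xw wm]; split=> //=; rewrite addrK.
  exact: (reach_map YXI (@adj_shift z) (dense_in_reach Yd eta1 Yb Yx bm xz)).
- move=> i; have [ri ni] := dP i; have [ui _] := cP i; split.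
    apply: (unbounded_reach_shift YXD); first exact: adj_shift.
    exact: (unbounded_reach_reach adj_sym ri ui).
  have [p [Yp pm dp]] := near_cball_adj Yd eta2 ni.
  exists (p + z); split; [exact/YX|by rewrite addrK|exact: adj_shift].
- move=> i j ij /(reach_map XYD (@adj_shift _)); rewrite !addrK => r.
  apply: (cN i j ij); have [ri _] := dP i; have [rj _] := dP j.
apply: (reach_trans ri); apply: (reach_trans r).
exact: (reach_sym adj_sym rj).
Qed.

End adjacency.

(** * Counting trifurcations *)

(** Encode [f] by an index where it takes a value in [H], that value, and the other [n] values. *)
Lemma card_ffun_exists (n N : nat) (H : {set 'I_N}) :
  (#|[set f : {ffun 'I_n.+1 -> 'I_N} | [exists i, f i \in H]]%SET| <=
    n.+1 * (#|H| * N ^ n))%N.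
Proof.
set S := (X in #|X|).
(* The default [ord0] is taken only outside the set being counted. *)
pose idx (f : {ffun 'I_n.+1 -> 'I_N}) := odflt ord0 [pick i | f i \in H].
pose g f : 'I_n.+1 * ('I_N * {ffun 'I_n -> 'I_N}) :=
  (idx f, (f (idx f), [ffun k => f (lift (idx f) k)])).
have ginj : injective g.
  move=> f1 f2 [e1 e2 /ffunP e3]; apply/ffunP => i.
  move: e2 e3; rewrite -e1 => e2 e3.
  have [k ->|->//] := unliftP (idx f1) i.
  by have := e3 k; rewrite !ffunE.
rewrite -(card_imset _ ginj).
have <- : #|finset.setX [set: 'I_n.+1]%SET
    (finset.setX H [set: {ffun 'I_n -> 'I_N}]%SET)| =
    (n.+1 * (#|H| * N ^ n))%N.
  by rewrite !cardsX !cardsT card_ffun !card_ord.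
apply: subset_leq_card; apply/fintype.subsetP => _ /imsetP[f + ->].
rewrite !inE /= andbT /idx => /existsP[i fi].
by case: pickP => [//|/(_ i)]; rewrite fi.
Qed.

Lemma card_ord_ends (a b : nat) :
  (#|[set v : 'I_(a + b).+1 | (v <= b) || (a <= v)]%SET| <= b.+1 + b.+1)%N.
Proof.
pose h (k : 'I_(b.+1 + b.+1)) : 'I_(a + b).+1 :=
  if (k <= b)%N then inord k else inord (a + (k - b.+1)).
apply: (@leq_trans #|h @: [set: 'I_(b.+1 + b.+1)]%SET|); last first.
  by rewrite (leq_trans (leq_imset_card _ _))// cardsT card_ord.
apply: subset_leq_card; apply/fintype.subsetP => v; rewrite inE => vab.
have [vb|bv] := leqP v b.
  have vlt : (v < b.+1 + b.+1)%N by lia.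
  by apply/imsetP; exists (Ordinal vlt); rewrite ?inE// /h /= vb inord_val.
have av : (a <= v)%N by move: vab; rewrite leqNgt bv.
have vlt : (b.+1 + (v - a) < b.+1 + b.+1)%N by have := ltn_ord v; lia.
apply/imsetP; exists (Ordinal vlt); rewrite ?inE// /h /=.
rewrite ifF; last by apply/negbTE; lia.
by rewrite addKn subnKC// inord_val.
Qed.

Section count.
Variables (R : realType) (n : nat) (rho : R).
Hypothesis rho_gt0 : 0 < rho.
Local Notation V := 'rV[R]_n.+1.
Local Notation adj := (@adj R n.+1 rho).
Implicit Types (X : set V) (x y z : V).

(** Steps are shorter than [rho], so a path cannot jump over a layer of that width. *)
Lemma unbounded_reach_layer X x (M : R) : unbounded_reach adj X x ->
  `|x| <= M + rho ->
  exists y, [/\ reach adj X x y, M < `|y| & `|y| <= M + rho].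
Proof.
move=> [Xx ux] xM.
have step z : reach adj X x z -> `|z| <= M \/
    exists y, [/\ reach adj X x y, M < `|y| & `|y| <= M + rho].
  elim=> [_|y1 y2 r1 IH Xy2 e12].
    have [|xM'] := leP `|x| M; [by left|right; exists x; split=> //].
    exact: reach_refl.
  have [y1M|//] := IH; last by right.
  have [|y2M] := leP `|y2| M; [by left|right; exists y2; split=> //].
    exact: reach_step r1 Xy2 e12.
  rewrite -[y2](subrK y1) addrC (le_trans (ler_normD _ _))// lerD//.
  by rewrite distrC ltW// adj_range.
have [y xy My] := ux (Num.truncn `|M|).+1.
have [yM|//] := step y xy.
have := lt_le_trans My yM; rewrite ltNge => /negP[].
by rewrite (le_trans (ler_norm M))// ltW// truncnS_gt.
Qed.

Variables (m : R).
Hypothesis m_ge0 : 0 <= m.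

(** [w] is the distance in [adj_near] for dimension [n.+1], so points of a common cell of side [w]
    are adjacent. The grid spacing [l * w] is a multiple of [w] exceeding [2 * m], which makes the
    cubes disjoint. *)
Let s := n.+2.
Let w : R := rho / s%:R.
Let l := (Num.truncn (2 * m / w)).+1.

Let w_gt0 : 0 < w. Proof. by rewrite divr_gt0. Qed.

Let rhoE : rho = s%:R * w. Proof. by rewrite mulrC divfK// pnatr_eq0. Qed.

Let lw : 2 * m < l%:R * w.
Proof. by rewrite -ltr_pdivrMr// truncnS_gt. Qed.

Definition grid_center (K : nat) (a : {ffun 'I_n.+1 -> 'I_K}) : V :=
  \row_i ((a i)%:R * (l%:R * w)).

Lemma grid_center_disjoint K (a b : {ffun 'I_n.+1 -> 'I_K}) x : a != b ->
  `|x - grid_center a| <= m -> ~ (`|x - grid_center b| <= m).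
Proof.
move=> ab xa xb; have [i abi] : exists i, a i != b i.
  apply: contrapT => /forallNP h; move/eqP: ab; apply; apply/ffunP => i.
  by apply/eqP/negPn/negP; exact: h.
have : `|(grid_center b - grid_center a) ord0 i| <= 2 * m.
  apply: le_trans (normr_rV_ge _ _) _.
  have -> : grid_center b - grid_center a =
      (x - grid_center a) - (x - grid_center b).
    by apply/rowP => k; rewrite !mxE; ring.
  by rewrite (le_trans (ler_normB _ _))// mulr_natl mulr2n lerD.
rewrite !mxE -mulrBl normrM [X in _ * X]ger0_norm; last first.
  by rewrite mulr_ge0// ltW.
apply/negP; rewrite -ltNge; apply: (lt_le_trans lw).
rewrite ler_peMl//; first by rewrite mulr_ge0// ltW.
have : (a i < b i)%N || (b i < a i)%N by rewrite -neq_ltn.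
rewrite ler_normr => /orP[h|h]; apply/orP.
  by left; rewrite lerBrDr nat1r ler_nat.
by right; rewrite opprB lerBrDr nat1r ler_nat.
Qed.

Lemma grid_center_le K (a : {ffun 'I_n.+1 -> 'I_K}) y :
  `|y - grid_center a| <= m -> `|y| <= (K * l)%:R * w.
Proof.
move=> ya; have lw0 : 0 < l%:R * w by rewrite mulr_gt0// ltr0n.
rewrite -[y](subrK (grid_center a)) (le_trans (ler_normD _ _))//.
apply: (@le_trans _ _ (l%:R * w + (K%:R - 1) * (l%:R * w))); last first.
  by rewrite natrM; lra.
apply: lerD; first by apply: (le_trans ya); move: m_ge0 lw; lra.
(* The very existence of [a] shows that [K] is positive. *)
have K1 : 0 <= (K%:R - 1) * (l%:R * w).
  rewrite mulr_ge0 ?subr_ge0 ?ler1n//; last exact: ltW.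
  exact: leq_ltn_trans (leq0n _) (ltn_ord (a ord0)).
rewrite leNgt; apply/negP => /(normr_rV_gt K1)[i].
rewrite mxE ger0_norm; last by rewrite mulr_ge0// ltW.
by rewrite ltr_pM2r// ltrBlDr natr1 ltr_nat ltnS leqNgt ltn_ord.
Qed.

(** Counts the cells of the layer: one of [n.+1] coordinates is extreme, with [s.+1] values at each
    end; each of the others has at most [(2 * l + 2 * s + 1) * K] values. *)
Let C := (n.+1 * ((s.+1 + s.+1) * (2 * l + 2 * s + 1) ^ n))%N.

(* Every branch of a trifurcation crosses the layer of width rho around the cube
   containing all the balls.  Points of that layer in a common cell of side w
   are adjacent, so the number of cells, which has order K ^ n, bounds the
   number of trifurcations. *)
Lemma card_trifurcation_le K X (Z : {set {ffun 'I_n.+1 -> 'I_K}}) :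
  (0 < K)%N -> (forall a, a \in Z -> trifurcation rho X (grid_center a) m) ->
  (#|Z| <= C * K ^ n)%N.
Proof.
move=> K0 tri.
pose M : R := (K * l)%:R * w.
(* In units of [w], coordinates shifted by [M + rho] range from 0 to [2 * (K * l) + 2 * s], both
   included, hence the successor. *)
pose N := (2 * (K * l) + s + s)%N.+1.
pose lab x : {ffun 'I_n.+1 -> 'I_N} :=
  [ffun i => inord (Num.truncn ((x ord0 i + M + rho) / w))].
pose layer := [set x : V | M < `|x| /\ `|x| <= M + rho].
have argE : M + rho = (K * l + s)%:R * w by rewrite natrD mulrDl rhoE.
have arg_ge0 x i : layer x -> 0 <= (x ord0 i + M + rho) / w.
  move=> [_ xM]; apply: divr_ge0; last exact: ltW.
  have := le_trans (normr_rV_ge x i) xM.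
  rewrite ler_norml => /andP[h _]; lra.
have arg_le x i : layer x ->
    (x ord0 i + M + rho) / w <= (2 * (K * l) + s + s)%:R.
  move=> [_ xM]; rewrite ler_pdivrMr// -addrA.
  have := le_trans (normr_rV_ge x i) xM; rewrite ler_norml => /andP[_ h].
  apply: le_trans (lerD h (lexx _)) _.
  rewrite argE -mulrDl -natrD ler_wpM2r//; first exact: ltW.
  by rewrite ler_nat; lia.
have labE x i : layer x ->
    nat_of_ord (lab x i) = Num.truncn ((x ord0 i + M + rho) / w).
  move=> Lx; rewrite ffunE inordK// /N ltnS -(@ler_nat R).
  by apply: le_trans (arg_le x i Lx); rewrite truncn_le// arg_ge0.
(* The labels of coordinates of absolute value above [M]. *)
pose E := [set v : 'I_N | ((v <= s) || (2 * (K * l) + s <= v))%N]%SET.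
pose Y := [set f : {ffun 'I_n.+1 -> 'I_N} | [exists i, f i \in E]]%SET.
have M0 : 0 <= M by rewrite mulr_ge0// ltW.
have labY x : layer x -> lab x \in Y.
  move=> Lx; have [Mx _] := Lx; have [i Mxi] := normr_rV_gt M0 Mx.
  rewrite inE; apply/existsP; exists i; rewrite inE labE//.
  have [xi0|xi0] := leP 0 (x ord0 i).
    apply/orP; right; rewrite truncn_ge_nat ?arg_ge0// ler_pdivlMr//.
    rewrite -addrA argE !(natrD _ _ s).
    rewrite (mulrDl (2 * (K * l))%:R) (mulrDl (K * l)%:R).
    move: Mxi; rewrite ger0_norm// /M => Mxi.
    rewrite (natrM _ 2) -[2 * _ * w]mulrA; move: Mxi.
    move: ((K * l)%:R * w) (s%:R * w) => u v; lra.
  apply/orP; left.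
  rewrite -(@ler_nat R); apply: (@le_trans _ _ ((x ord0 i + M + rho) / w)).
    by rewrite truncn_le// arg_ge0.
  rewrite ler_pdivrMr// -rhoE.
  move: Mxi; rewrite ltr0_norm//; lra.
have lab_adj x y : layer x -> layer y -> lab x = lab y -> adj x y.
  move=> Lx Ly xy; apply: adj_near => //; rewrite -/s -/w.
  apply: normr_rV_lt => // i; rewrite !mxE.
  have xyi : Num.truncn ((x ord0 i + M + rho) / w) =
      Num.truncn ((y ord0 i + M + rho) / w).
    by rewrite -!labE// xy.
  have /andP[x1 x2] := truncn_itv (arg_ge0 x i Lx).
  have /andP[y1 y2] := truncn_itv (arg_ge0 y i Ly).
  rewrite -xyi in y1 y2; move: x1 x2 y1 y2.
  set q := Num.truncn _; rewrite ler_pdivlMr// ltr_pdivrMr// => x1 x2.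
  rewrite ler_pdivlMr// ltr_pdivrMr// => y1 y2.
  move: x2 y2; rewrite -natr1 mulrDl mul1r => x2 y2.
  rewrite ltr_norml; apply/andP; split; lra.
have {tri} /choice[bc bcP] : forall a, exists bc : V * ('I_3 -> V), a \in Z ->
    [/\ X bc.1 /\ `|bc.1 - grid_center a| <= m,
      forall x, X x -> `|x - grid_center a| <= m ->
        reach adj (X `&` [set x : V | `|x - grid_center a| <= m]) bc.1 x,
      forall i,
        unbounded_reach adj (X `\` [set x : V | `|x - grid_center a| <= m])
          (bc.2 i) /\
        exists y, [/\ X y, `|y - grid_center a| <= m & adj (bc.2 i) y] &
      forall i j, i != j ->
        ~ reach adj (X `\` [set x : V | `|x - grid_center a| <= m])
          (bc.2 i) (bc.2 j)].
  move=> a; have [/tri[b [c h]]|aZ] := boolP (a \in Z); first by exists (b, c).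
  by exists (0, fun=> 0).
pose b a := (bc a).1; pose c a := (bc a).2.
pose B (a : {ffun 'I_n.+1 -> 'I_K}) := [set x : V | `|x - grid_center a| <= m].
have bP a : a \in Z -> X (b a) /\ B a (b a) by move=> /bcP[].
have bB a x : a \in Z -> X x -> B a x -> reach adj (X `&` B a) (b a) x.
  by move=> /bcP[_ + _ _]; exact.
have cU a i : a \in Z -> unbounded_reach adj (X `\` B a) (c a i).
  by move=> /bcP[_ _ /(_ i)[]].
have cB a i : a \in Z -> exists y, [/\ X y, B a y & adj (c a i) y].
  by move=> /bcP[_ _ /(_ i)[]].
have cN a i j : a \in Z -> i != j -> ~ reach adj (X `\` B a) (c a i) (c a j).
  by move=> /bcP[_ _ _]; exact.
have asym := @adj_sym R n.+1 rho.
have BD a a' x : a != a' -> B a x -> ~ B a' x by exact: grid_center_disjoint.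
pose t a i a' : bool := `[< reach adj (X `\` B a) (c a i) (b a') >].
pose H a i : {set {ffun 'I_n.+1 -> 'I_N}} := [set f |
  `[< exists x,
    [/\ reach adj (X `\` B a) (c a i) x, layer x & lab x = f] >]]%SET.
(* A branch of [a] that misses [b a'] misses the whole cube of [a'], whose points are joined to
   [b a'] inside it. With the cube of [a] it therefore lies in one component of the complement of
   the cube of [a']. *)
have key a a' i x : a \in Z -> a' \in Z -> a != a' -> ~~ t a i a' ->
    reach adj (X `\` B a) (c a i) x -> reach adj (X `\` B a') (b a) x.
  move=> aZ a'Z aa' nt cx.
  have avoid z : reach adj (X `\` B a) (c a i) z -> (X `\` B a') z.
    move=> cz; split; first by have [] := reachr cz.
    move=> Bz; move/negP: nt; apply; apply/asboolP.
    apply: (reach_trans cz); apply: (reach_sym asym).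
    apply: (@reachS _ _ (X `&` B a')).
      by move=> u [Xu Bu]; split=> //; apply: BD Bu; rewrite eq_sym.
    by apply: bB => //; have [] := reachr cz.
  have [y [Xy By cy]] := cB a i aZ.
  have by' : reach adj (X `\` B a') (b a) y.
    apply: (@reachS _ _ (X `&` B a)); last exact: bB.
    by move=> u [Xu Bu]; split=> //; exact: BD Bu.
  apply: reach_trans (reach_sub avoid cx).
  apply: (reach_step by'); last exact: asym.
  by apply: avoid; apply: reach_refl; have [] := cU a i aZ.
have bsys : branch_system H t Z.
  split.
  - move=> a i j aZ ij; apply/pred0P => f /=; apply/negbTE/negP.
    rewrite !inE => /andP[/asboolP[x [cx Lx xf]] /asboolP[y [cy Ly yf]]].
    apply: (cN a i j aZ ij); apply: (reach_trans cx).
    apply: reach_trans (reach_sym asym cy); apply: reach1.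
    + exact: reachr cx.
    + exact: reachr cy.
    + by apply: lab_adj => //; rewrite xf yf.
  - move=> a i j a' aZ a'Z aa' /asboolP ri /asboolP rj.
    apply: contrapT => /eqP ij; apply: (cN a i j aZ ij).
    exact: reach_trans ri (reach_sym asym rj).
  - move=> a i a' j aZ a'Z aa' nt; split.
    + move=> /asboolP tj; apply/fintype.subsetP => f.
      rewrite !inE => -[x [cx Lx xf]]; exists x; split=> //.
      apply: (reach_trans tj); exact: key aZ a'Z aa' nt cx.
    + move=> /asboolP ntj; apply/pred0P => f /=; apply/negbTE/negP.
      rewrite !inE => /andP[/asboolP[x [cx Lx xf]] /asboolP[y [cy Ly yf]]].
      apply: ntj; apply: (reach_trans cy); apply: (reach_sym asym).
      have bx := key _ _ _ _ aZ a'Z aa' nt cx.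
      apply: (reach_step bx); first exact: reachr cy.
      by apply: lab_adj => //; rewrite xf yf.
    + move=> a'' a''Z _ _ /asboolP tia''.
      have ba'' := key _ _ _ _ aZ a'Z aa' nt tia''.
      apply/asboolP/asboolP => r; last exact: reach_trans r ba''.
      exact: reach_trans r (reach_sym asym ba'').
(* Every branch starts within [M + rho] and is unbounded, so it has a label in the layer. *)
apply: leq_trans (card_branch_system (Y := Y) bsys _) _.
  move=> a i aZ; have [y [Xy By cy]] := cB a i aZ.
  have cM : `|c a i| <= M + rho.
    rewrite -[c a i](subrK y) addrC (le_trans (ler_normD _ _))// lerD//.
      exact: grid_center_le By.
    exact/ltW/adj_range.
  have [x [cx Mx xM]] := unbounded_reach_layer (cU a i aZ) cM.
  exists (lab x); last exact: labY.
  by rewrite inE; apply/asboolP; exists x.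
apply: (leq_trans (card_ffun_exists n E)).
rewrite /C -2!mulnA -expnMn leq_mul2l /= leq_mul//; first exact: card_ord_ends.
have NK : (N <= (2 * l + 2 * s + 1) * K)%N by rewrite /N; nia.
by case: (n) => [|n']; rewrite ?expn0// leq_exp2r.
Qed.

End count.

(** * Measurability *)

Section rational_cells.
Variables (R : realType) (n : nat).
Local Notation V := 'rV[R]_n.

Lemma open_norm_rV (U : set V) :
  (forall x, U x -> exists2 e : R, 0 < e & forall y, `|y - x| < e -> U y) ->
  open U.
Proof.
move=> h; rewrite openE => x /h[e e0 eU].
apply/nbhs_ballP; exists e => //= y; rewrite -ball_normE /= => xy.
by apply: eU; rewrite distrC.
Qed.

Lemma open_norm_rVP (U : set V) x : open U -> U x ->
  exists2 e : R, 0 < e & forall y, `|y - x| < e -> U y.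
Proof.
rewrite openE => /[apply] /nbhs_ballP[e /= e0 eU]; exists e => // y xy.
by apply: eU; rewrite -ball_normE /= distrC.
Qed.

Definition sup_ball (q : V) (e : R) : set V := [set x | `|x - q| < e].

Lemma sup_ball_open q e : open (sup_ball q e).
Proof.
apply: open_norm_rV => x xq; exists (e - `|x - q|); first by rewrite subr_gt0.
move=> y; rewrite ltrBrDr => h; apply: le_lt_trans h.
by rewrite -{1}[y](subrK x) -addrA ler_normD.
Qed.

Lemma measurable_sup_ball q e : measurable (sup_ball q e).
Proof. by apply: open_measurable_mx; exact: sup_ball_open. Qed.

Definition cell (a : 'rV[rat]_n * nat) : set V :=
  sup_ball (map_mx ratr a.1) a.2.+1%:R^-1.

Lemma exists_cell_center (k : nat) x : exists q, cell (q, k) x.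
Proof.
have /choice[q qP] : forall i, exists r : rat,
    `|x ord0 i - ratr r| < k.+1%:R^-1.
  move=> i; have : x ord0 i - k.+1%:R^-1 < x ord0 i + k.+1%:R^-1.
    by rewrite ltrD2l gt0_cp// invr_gt0.
  move=> /rat_in_itvoo[r]; rewrite in_itv /= => /andP[h1 h2].
  exists r; rewrite ltr_norml; move: (k.+1%:R^-1) h1 h2 => u h1 h2.
  by apply/andP; split; lra.
exists (\row_i q i); rewrite /cell /sup_ball /=; apply: normr_rV_lt => // i.
by rewrite !mxE; exact: qP.
Qed.

Lemma exists_cell (U : set V) x : open U -> U x ->
  exists a, cell a x /\ cell a `<=` U.
Proof.
move=> oU Ux; have [e e0 eU] := open_norm_rVP oU Ux.
pose k := Num.truncn (2 / e).
have k2 : 2 * k.+1%:R^-1 < e.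
  by rewrite ltr_pdivrMr// -ltr_pdivrMl// mulrC truncnS_gt.
have [q qx] := exists_cell_center k x.
exists (q, k); split=> // y /= yq; apply: eU.
apply: lt_trans k2; rewrite mulr_natl mulr2n.
rewrite -[y](subrK (map_mx ratr q)) -addrA (le_lt_trans (ler_normD _ _))//.
by rewrite ltrD// distrC.
Qed.

End rational_cells.

Section open_sets_adj.
Variables (R : realType) (n : nat).
Local Notation V := 'rV[R]_n.

Lemma far_open (m : R) : open [set x : V | m < `|x|].
Proof.
apply: open_norm_rV => x mx; exists (`|x| - m); first by rewrite subr_gt0.
move=> y; rewrite distrC => /(le_lt_trans (lerB_dist _ _)).
by rewrite ltrD2l ltrN2.
Qed.

Lemma open_euclidean_ball (z : V) (e : R) : open (euclidean_ball z e).
Proof.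
apply: open_norm_rV => u zu; exists ((e - euclidean_norm (z - u)) / n.+1%:R).
  by rewrite divr_gt0// subr_gt0.
move=> v; rewrite ltr_pdivlMr// => vu.
apply: le_lt_trans (euclidean_dist_triangle u _ _) _.
rewrite addrC -ltrBrDr; apply: le_lt_trans vu.
by rewrite mulrC distrC euclidean_norm_le.
Qed.

Lemma adj_open rho (y z : V) : adj rho y z -> exists Uy Uz : set V,
  [/\ open Uy, open Uz, Uy y, Uz z &
    forall u v, Uy u -> Uz v -> adj rho u v].
Proof.
rewrite /adj => yz.
pose e := (rho - euclidean_norm (y - z)) / 2.
have e0 : 0 < e by rewrite divr_gt0// subr_gt0.
exists (euclidean_ball y e), (euclidean_ball z e).
split; [exact: open_euclidean_ball|exact: open_euclidean_ball| | |].
- by rewrite /euclidean_ball /= subrr euclidean_norm0.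
- by rewrite /euclidean_ball /= subrr euclidean_norm0.
move=> u v; rewrite /euclidean_ball /= euclidean_distC => uy vz.
apply: le_lt_trans (euclidean_dist_triangle y _ _) _.
have := euclidean_dist_triangle z y v; move: uy vz; rewrite /e; lra.
Qed.

Lemma near_cball_open (m s : R) : open (@near_cball R n m s).
Proof.
rewrite (_ : near_cball m s =
    \bigcup_(y in [set y | `|y| <= m]) euclidean_ball y s).
  by apply: bigcup_open => y _; exact: open_euclidean_ball.
by apply/seteqP; split=> x [y ym]; rewrite /euclidean_ball /= euclidean_distC;
  exists y.
Qed.

End open_sets_adj.

(** * Countable combinations of events *)

Section measurable_props.
Context d (T : measurableType d).

Lemma measurable_exists (C : countType) (F : C -> set T) :
  (forall c, measurable (F c)) -> measurable [set t | exists c, F c t].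
Proof.
move=> mF; rewrite (_ : [set t | _] = \bigcup_c F c).
  by apply: countable_bigcupT_measurable => //; exact: countableP.
by apply/seteqP; split=> [t [c Fc]|t [c _ Fc]]; exists c.
Qed.

Lemma measurable_not (F : set T) : measurable F -> measurable [set t | ~ F t].
Proof. exact: measurableC. Qed.

Lemma measurable_forall (C : countType) (F : C -> set T) :
  (forall c, measurable (F c)) -> measurable [set t | forall c, F c t].
Proof.
move=> mF; rewrite (_ : [set t | _] = ~` [set t | exists c, ~ F c t]).
  apply: measurableC; apply: measurable_exists => c; exact: measurable_not.
rewrite predeqE => t /=; rewrite -forallNP.
by split=> h c; [rewrite notK|apply: contrapT].
Qed.

Lemma measurable_andP (P : Prop) (F : set T) :
  measurable F -> measurable [set t | P /\ F t].
Proof.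
move=> mF; have [p|np] := pselect P.
  by rewrite (_ : [set t | _] = F)//; apply/seteqP; split=> t //= [].
by rewrite (_ : [set t | _] = set0)//; apply/seteqP; split=> t //= [].
Qed.

Lemma measurable_reach (C : countType) (e : C -> C -> Prop) (F : C -> set T)
    (a b : C) : (forall c, measurable (F c)) ->
  measurable [set t | reach e [set c | F c t] a b].
Proof.
move=> mF.
(* [step k b] is the event of a path with [k] edges from [a] to [b]; the graph being countable, each
   is a countable union. *)
pose fix step (k : nat) (b : C) {struct k} : set T :=
  if k is k'.+1 then [set t | exists c, (e c b /\ (step k' c t)) /\ F b t]
  else [set t | a = b /\ F b t].
have mstep k : forall b, measurable (step k b).
  elim: k => [|k IH] c /=; first exact: measurable_andP.
  apply: measurable_exists => c'; apply: measurableI => //.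
  exact: measurable_andP.
rewrite (_ : [set t | _] = [set t | exists k, step k b t]).
  by apply: measurable_exists => k; exact: mstep.
apply/seteqP; split=> t.
  elim=> [Fa|y z _ [k kP] Fz eyz]; first by exists 0%N.
  by exists k.+1; exists y.
move=> [k]; elim: k b => [|k IH] b /= ; first by move=> [<-]; exact: reach_refl.
by move=> [c [[ecb /IH ac] Fb]]; exact: reach_step ac Fb ecb.
Qed.

End measurable_props.

Section random_measures.
Context d (T : measurableType d) (R : realType).

Lemma measurable_ev (A : set T) : measurable A ->
  measurable_fun setT (fun mu : measures T R => mu A).
Proof.
move=> mA _ Y mY; apply: sub_sigma_algebra; exists A => //.
by exists Y.
Qed.

Lemma measurable_fun_measures d' (T' : measurableType d')
    (f : T' -> measures T R) :
  (forall A, measurable A -> measurable_fun setT (fun t => f t A)) ->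
  measurable_fun setT f.
Proof.
move=> fA; apply: (measurability (@ev_sets _ T R)) => //.
move=> _ [_ [A mA [Y mY <-]] <-]; rewrite setTI.
by have := fA A mA measurableT Y mY; rewrite !setTI.
Qed.

Lemma measurable_charged (A : set T) : measurable A ->
  measurable [set mu : measures T R | (0 < mu A)%E].
Proof.
move=> mA; rewrite -[X in measurable X]setTI.
by apply: emeasurable_fun_o_infty => //; exact: measurable_ev.
Qed.

End random_measures.

(** * Events described by paths of charged cells *)

Section path_events.
Variables (R : realType) (n : nat) (rho : R).
Hypothesis rho_gt0 : 0 < rho.
Local Notation V := 'rV[R]_n.
Local Notation M := (measures 'rV[R]_n R).
Local Notation adj := (@adj R n rho).
Implicit Types (mu : M) (X U W : set V) (m s : R).

(** All that the events need to know about [mu]. A general [X] instead of [mu_support mu] lets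
    translates be treated through the shifted set. *)
Definition charges mu X : Prop :=
  forall U, open U -> (0 < mu U)%E <-> X `&` U !=set0.

Definition cell_adj (a b : 'rV[rat]_n * nat) : Prop :=
  forall x y, cell a x -> cell b y -> adj x y.

Definition charged_cells W mu : set ('rV[rat]_n * nat) :=
  [set a | cell a `<=` W /\ (0 < mu (cell a))%E].

Definition path_event W U U' : set M := [set mu |
  exists ab : ('rV[rat]_n * nat) * ('rV[rat]_n * nat),
    (cell ab.1 `<=` U /\ cell ab.2 `<=` U') /\
    reach cell_adj (charged_cells W mu) ab.1 ab.2].

Lemma measurable_path_event W U U' : measurable (path_event W U U').
Proof.
apply: measurable_exists => ab; apply: measurable_andP.
apply: (@measurable_reach _ _ _ _ (fun c => [set mu | charged_cells W mu c])).
move=> c; apply: measurable_andP; apply: measurable_charged.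
exact: measurable_sup_ball.
Qed.

(** Charged cells contain points of [X], and conversely a path of points thickens to a path of
    cells, because adjacency, [W], [U] and [U'] are open. *)
Lemma path_eventP mu X W U U' : charges mu X -> open W -> open U -> open U' ->
  path_event W U U' mu <->
  exists x y, [/\ U x, U' y & reach adj (X `&` W) x y].
Proof.
move=> muX oW oU oU'; split.
  move=> [[a b] /= [[aU bU'] ab]].
  have ch c : charged_cells W mu c -> exists2 x, X x & cell c x.
    by move=> [_ /(muX _ (@sup_ball_open R n _ _))[x [Xx cx]]]; exists x.
  have [y Xy By] := ch b (reachr ab).
  suff [x [ax xy]] : exists x, cell a x /\ reach adj (X `&` W) x y.
    by exists x, y; split; [exact: aU|exact: bU'|].
  elim: ab {bU'} y Xy By => [[aW _] y Xy ay|c e ac IH ec ce y Xy ey].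
    by exists y; split=> //; apply: reach_refl; split=> //; exact: aW.
  have [z Xz cz] := ch c (reachr ac).
  have [x [ax xz]] := IH z Xz cz; exists x; split=> //.
  apply: (reach_step xz); last exact: ce.
  by split=> //; case: ec => + _; exact.
move=> [x [y [Ux U'y xy]]].
suff [a [b [aU bU' ab]]] : exists a b, [/\ cell a `<=` U, cell b `<=` U' &
    reach cell_adj (charged_cells W mu) a b].
  by exists (a, b).
have ch a z : X z -> cell a z -> (0 < mu (cell a))%E.
  by move=> Xz az; apply/(muX _ (@sup_ball_open R n _ _)); exists z.
suff : exists a b, [/\ cell a `<=` U, cell b `<=` U', cell b y &
    reach cell_adj (charged_cells W mu) a b].
  by move=> [a [b [? ? _ ?]]]; exists a, b.
(* [U'] varies in the induction so that the last cell can be taken small enough for the next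
   edge. *)
elim: xy U' oU' U'y => [[Xx Wx]|z z' xz IH [Xz Wz] zz'] U' oU' U'y.
  have [a [ax]] :=
    exists_cell (openI oW (openI oU oU')) (conj Wx (conj Ux U'y)).
  rewrite !subsetI => -[aW [aU aU']]; exists a, a; split=> //.
  by apply: reach_refl; split=> //; exact: ch ax.
have [N1 [N2 [oN1 oN2 N1z N2z N12]]] := adj_open zz'.
have [a [b [aU bN1 bz ab]]] := IH N1 oN1 N1z.
have [c [cz]] :=
  exists_cell (openI oW (openI oU' oN2)) (conj Wz (conj U'y N2z)).
rewrite !subsetI => -[cW [cU' cN2]]; exists a, c; split=> //.
apply: (reach_step ab); first by split=> //; exact: ch cz.
by move=> u v bu cv; apply: N12; [exact: bN1|exact: cN2].
Qed.

(** The radius is less than half of [rho / n.+1]: the points of a small cell are pairwise adjacent,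
    so a rational center names at most one component. *)
Definition small_cell (q : 'rV[rat]_n) : set V :=
  cell (q, Num.truncn (2 * n.+1%:R / rho)).

Lemma open_small_cell q : open (small_cell q).
Proof. exact: sup_ball_open. Qed.

Lemma small_cell_adj q x y : small_cell q x -> small_cell q y -> adj x y.
Proof.
rewrite /small_cell /cell /sup_ball /= => xq yq; apply: adj_near => //.
rewrite -[x](subrK (map_mx ratr q)) -addrA (le_lt_trans (ler_normD _ _))//.
apply: lt_trans (_ : 2 * (Num.truncn (2 * n.+1%:R / rho)).+1%:R^-1 < _).
  by rewrite mulr_natl mulr2n ltrD// distrC.
rewrite ltr_pdivrMr// mulrAC ltr_pdivlMr//.
by rewrite (mulrC rho) -ltr_pdivrMr// truncnS_gt.
Qed.

Definition unbounded_event W q : set M := [set mu |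
  forall j : nat, path_event W (small_cell q) [set x | j%:R < `|x|] mu].

Lemma measurable_unbounded_event W q : measurable (unbounded_event W q).
Proof. by apply: measurable_forall => j; exact: measurable_path_event. Qed.

(** The starting point may depend on [j], but all candidates lie in one small cell and hence in one
    component. *)
Lemma unbounded_eventP mu X W q : charges mu X -> open W ->
  unbounded_event W q mu <->
  exists2 x, small_cell q x & unbounded_reach adj (X `&` W) x.
Proof.
move=> muX oW; split.
  move=> h.
  have {}h j : exists x y, [/\ small_cell q x, j%:R < `|y| &
      reach adj (X `&` W) x y].
    by have /(path_eventP muX oW (@open_small_cell q) (@far_open R n j%:R)) :=
      h j.
  have [x [y0 [qx _ xy0]]] := h 0%N.
  exists x => //; split; first exact: reachl xy0.
  move=> j; have [x' [y [qx' jy x'y]]] := h j; exists y => //.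
  apply: (reach_trans _ x'y); apply: reach1; [exact: reachl xy0| |].
    exact: reachl x'y.
  exact: small_cell_adj qx qx'.
move=> [x qx [XWx ux]] j.
apply/(path_eventP muX oW (@open_small_cell q) (@far_open R n j%:R)).
by have [y xy jy] := ux j; exists x, y.
Qed.

Lemma small_cell_pathP mu X W q q' x x' : charges mu X -> open W ->
  small_cell q x -> small_cell q' x' -> (X `&` W) x -> (X `&` W) x' ->
  path_event W (small_cell q) (small_cell q') mu <-> reach adj (X `&` W) x x'.
Proof.
move=> muX oW qx qx' Xx Xx'; split; last first.
  move=> xx'.
  apply/(path_eventP muX oW (@open_small_cell _) (@open_small_cell _)).
  by exists x, x'.
move=> /(path_eventP muX oW (@open_small_cell _) (@open_small_cell _)).
move=> [y [y' [qy qy' yy']]].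
apply: (@reach_trans _ _ _ _ y).
  by apply: reach1 => //; [exact: reachl yy'|exact: small_cell_adj qx qy].
apply: (reach_trans yy'); apply: reach1 => //; first exact: reachr yy'.
exact: small_cell_adj qy' qx'.
Qed.

Lemma small_cell_path_openP mu X W U q x : charges mu X -> open W -> open U ->
  small_cell q x -> (X `&` W) x ->
  path_event W (small_cell q) U mu <->
  exists2 y, reach adj (X `&` W) x y & U y.
Proof.
move=> muX oW oU qx Xx; split.
  move=> /(path_eventP muX oW (@open_small_cell q) oU)[x' [y [qx' Uy x'y]]].
  exists y => //; apply: (reach_trans _ x'y); apply: reach1 => //.
    exact: reachl x'y.
  exact: small_cell_adj qx qx'.
move=> [y xy Uy]; apply/(path_eventP muX oW (@open_small_cell q) oU).
by exists x, y.
Qed.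

Lemma exists_small_cell x : exists q, small_cell q x.
Proof. exact: exists_cell_center. Qed.

Definition two_event : set M := [set mu | exists q : 'rV[rat]_n * 'rV[rat]_n,
  (unbounded_event setT q.1 mu /\ unbounded_event setT q.2 mu) /\
  ~ path_event setT (small_cell q.1) (small_cell q.2) mu].

Lemma measurable_two_event : measurable two_event.
Proof.
apply: measurable_exists => q; apply: measurableI.
  by apply: measurableI; exact: measurable_unbounded_event.
by apply: measurable_not; exact: measurable_path_event.
Qed.

Lemma two_eventP mu X : charges mu X -> two_event mu <-> two_unbounded rho X.
Proof.
move=> muX; rewrite -[X in two_unbounded _ X]setIT; split.
  move=> [[q1 q2] /= [[]]].
  move=> /(unbounded_eventP _ muX openT)[x1 qx1 u1].
  move=> /(unbounded_eventP _ muX openT)[x2 qx2 u2] np.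
  exists x1, x2; split=> // r; apply: np.
  by apply/(small_cell_pathP muX openT qx1 qx2 u1.1 u2.1).
move=> [x1 [x2 [u1 u2 nr]]].
have [q1 qx1] := exists_small_cell x1; have [q2 qx2] := exists_small_cell x2.
exists (q1, q2); split=> /=.
  by split; apply/(unbounded_eventP _ muX openT); [exists x1|exists x2].
by move=> /(small_cell_pathP muX openT qx1 qx2 u1.1 u2.1).
Qed.

Local Notation out m := (~` [set x : V | `|x| <= m]).

Lemma open_out m : open (out m).
Proof.
rewrite (_ : out m = [set x | m < `|x|]); first exact: far_open.
by apply/seteqP; split=> x /=; rewrite ltNge => /negP.
Qed.

Definition all_near_event m s : set M := [set mu | ~ exists q,
  unbounded_event (out m) q mu /\
  ~ path_event (out m) (small_cell q) (near_cball m s) mu].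

Lemma measurable_all_near_event m s : measurable (all_near_event m s).
Proof.
apply: measurable_not; apply: measurable_exists => q; apply: measurableI.
  exact: measurable_unbounded_event.
by apply: measurable_not; exact: measurable_path_event.
Qed.

Lemma all_near_eventP mu X m s :
  charges mu X -> all_near_event m s mu <-> all_near rho X m s.
Proof.
move=> muX; have oW := @open_out m.
have oN := @near_cball_open R n m s.
rewrite /all_near setDE; split.
  move=> h x ux; apply: contrapT => nx; apply: h.
  have [q qx] := exists_small_cell x; exists q; split.
    by apply/(unbounded_eventP _ muX oW); exists x.
  by move=> /(small_cell_path_openP muX oW oN qx ux.1).
move=> h [q [/(unbounded_eventP _ muX oW)[x qx ux]]]; apply.
by apply/(small_cell_path_openP muX oW oN qx ux.1); exact: h.
Qed.

(** The centers form a finite function, so that the quantifier ranges over a countable type. *)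
Definition three_near_event m s : set M := [set mu |
  exists q : {ffun 'I_3 -> 'rV[rat]_n},
  (forall i, unbounded_event (out m) (q i) mu /\
    path_event (out m) (small_cell (q i)) (near_cball m s) mu) /\
  (forall ij : 'I_3 * 'I_3, ~ (ij.1 != ij.2 /\
    path_event (out m) (small_cell (q ij.1)) (small_cell (q ij.2)) mu))].

Lemma measurable_three_near_event m s : measurable (three_near_event m s).
Proof.
apply: measurable_exists => q; apply: measurableI.
  apply: measurable_forall => i; apply: measurableI.
    exact: measurable_unbounded_event.
  exact: measurable_path_event.
apply: measurable_forall => ij; apply: measurable_not; apply: measurable_andP.
exact: measurable_path_event.
Qed.

Lemma three_near_eventP mu X m s :
  charges mu X -> three_near_event m s mu <-> three_near rho X m s.
Proof.
move=> muX; have oW := @open_out m.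
have oN := @near_cball_open R n m s.
rewrite /three_near setDE; split.
  move=> [q [hq hn]].
  have /choice[c cP] : forall i, exists x, small_cell (q i) x /\
      unbounded_reach adj (X `&` out m) x.
    move=> i; have [/(unbounded_eventP _ muX oW)[x qx ux] _] := hq i.
    by exists x.
  exists c; split.
    move=> i; have [qc uc] := cP i; split=> //.
    by have [_ h] := hq i; exact/(small_cell_path_openP muX oW oN qc uc.1).
  move=> i j ij r; apply: (hn (i, j)); split=> //=.
  have [qi ui] := cP i; have [qj uj] := cP j.
  by apply/(small_cell_pathP muX oW qi qj ui.1 uj.1).
move=> [c [hc hn]].
have /choice[q qP] := fun i => exists_small_cell (c i).
exists [ffun i => q i]; split.
  move=> i; rewrite ffunE; have [uc nc] := hc i; split.
    by apply/(unbounded_eventP _ muX oW); exists (c i).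
  by apply/(small_cell_path_openP muX oW oN (qP i) uc.1).
move=> [i j] /= [ij]; rewrite !ffunE.
have [ui _] := hc i; have [uj _] := hc j.
by move=> /(small_cell_pathP muX oW (qP i) (qP j) ui.1 uj.1); exact: hn.
Qed.

Lemma add_pointE mu u (A : set V) : add_point mu u A = (mu A + \d_u A)%E.
Proof.
by rewrite /add_point /= /measure_add /msum /= !big_ord_recl big_ord0 /= adde0.
Qed.

Lemma charged_cells_add_point W mu u : ~ W u ->
  charged_cells W (add_point mu u) = charged_cells W mu.
Proof.
move=> nWu.
have muE a : cell a `<=` W -> add_point mu u (cell a) = mu (cell a).
  move=> aW; have au : ~ cell a u by move=> /aW.
  by rewrite add_pointE diracE memNset// adde0.
by apply/seteqP; split=> a [aW mua]; split=> //; move: mua; rewrite muE.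
Qed.

Lemma all_near_event_add_point mu m s u : `|u| <= m ->
  all_near_event m s mu -> all_near_event m s (add_point mu u).
Proof.
move=> um; have nWu : ~ out m u by apply.
rewrite /all_near_event /unbounded_event /path_event /=.
by rewrite charged_cells_add_point.
Qed.

Lemma three_near_event_add_point mu m s u : `|u| <= m ->
  three_near_event m s mu -> three_near_event m s (add_point mu u).
Proof.
move=> um; have nWu : ~ out m u by apply.
rewrite /three_near_event /unbounded_event /path_event /=.
by rewrite charged_cells_add_point.
Qed.

End path_events.

(** * Uniform distribution on a cube *)

Section row_mx.
Variables (R : realType) (n : nat).
Implicit Types (x : R) (v : 'rV[R]_n) (q : 'rV[R]_(1 + n)) (e : R).

Lemma normr_row_mx_lt q x v e : 0 < e ->
  `|row_mx (x%:M : 'rV_1) v - q| < e <->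
  `|x - q ord0 ord0| < e /\ `|v - rsubmx q| < e.
Proof.
move=> e0; split=> [h|[hx hv]].
  split.
    have := le_lt_trans (normr_rV_ge _ (lshift n ord0)) h.
    rewrite !mxE (unsplitK (inl _)) !mxE /= mulr1n.
    by rewrite (_ : lshift n ord0 = ord0)//; exact: val_inj.
  apply: normr_rV_lt => // i.
  have := le_lt_trans (normr_rV_ge _ (rshift 1 i)) h.
  by rewrite !mxE (unsplitK (inr _)).
apply: normr_rV_lt => // i; rewrite !mxE.
case: splitP => j ij.
  rewrite !mxE (ord1 j) /= mulr1n (_ : i = ord0)//.
  by apply: val_inj; rewrite /= ij (ord1 j).
have := le_lt_trans (normr_rV_ge _ j) hv; rewrite !mxE.
by rewrite (_ : rshift 1 j = i)//; exact: val_inj.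
Qed.

(** An open set is a countable union of rational cubes, and the preimage of a cube is a product. *)
Lemma measurable_row_mx : measurable_fun setT
  (fun p : measurableTypeR R * 'rV[R]_n =>
    row_mx (p.1%:M : 'rV_1) p.2 : 'rV[R]_(n.+1)).
Proof.
apply: (measurability (@open 'rV[R]_n.+1)) => //.
move=> _ [G oG <-]; rewrite setTI.
pose F (a : 'rV[rat]_n.+1 * nat) : set (measurableTypeR R * 'rV[R]_n) :=
  [set p | cell a `<=` G /\
    ((ball (ratr (a.1 ord0 ord0) : R) a.2.+1%:R^-1 `*`
      sup_ball (@rsubmx _ _ 1 n (map_mx ratr a.1)) a.2.+1%:R^-1) p)].
rewrite (_ : _ @^-1` G = [set p | exists a, F a p]).
  apply: measurable_exists => a; apply: measurable_andP.
  apply: measurableX.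
    by apply: open_measurable; exact: ball_open.
  exact: measurable_sup_ball.
apply/seteqP; split=> -[x v] /=.
  move=> /(exists_cell oG)[a [ax aG]]; exists a; split=> //.
  move: ax; rewrite /cell /sup_ball /= => /normr_row_mx_lt.
  by rewrite invr_gt0 ltr0n -ball_normE /= distrC => /(_ isT); rewrite mxE.
move=> [a [aG [h1 h2]]]; apply: aG.
rewrite /cell /sup_ball /=; apply/normr_row_mx_lt; first by rewrite invr_gt0.
by move: h1; rewrite mxE -ball_normE /= distrC.
Qed.

End row_mx.

(** Identifies the iterated integral on a cube with a multiple of a product of uniform laws, which
    gives both the law of an inserted point and the volume of the cube. *)
Lemma uniform_sup_ball (R : realType) n (q : 'rV[R]_n) (e : R) : 0 < e ->
  exists P : probability 'rV[R]_n R, forall B, measurable B ->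
    lebesgue_rV (sup_ball q e `&` B) = (((2 * e) ^+ n)%:E * P B)%E.
Proof.
move=> e0; elim: n q => [|n IH] q.
  exists \d_(0 : 'rV[R]_0) => B mB; rewrite expr0 mul1e /=.
  rewrite !diracE; congr (_ %:R%:E)%E; rewrite in_setI.
  rewrite [X in X && _]mem_set//= /sup_ball /=.
  by rewrite (_ : 0 - q = 0) ?normr0//; apply/rowP => -[].
have [Pn PnE] := IH (@rsubmx _ _ 1 n q).
pose q0 := q ord0 ord0.
have ab : q0 - e < q0 + e by rewrite ltrD2l gt0_cp.
pose f (p : measurableTypeR R * 'rV[R]_n) : 'rV[R]_n.+1 :=
  row_mx (p.1%:M : 'rV_1) p.2.
have mf : measurable_fun setT f by exact: measurable_row_mx.
pose F : {mfun (measurableTypeR R * 'rV[R]_n)%type >-> 'rV[R]_n.+1} :=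
  HB.pack f (isMeasurableFun.Build _ _ _ _ f mf).
pose U : probability (measurableTypeR R) R := uniform_prob ab.
pose UP : probability (measurableTypeR R * 'rV[R]_n)%type R := (U \x Pn)%E.
exists (distribution UP F) => B mB.
have mFB : measurable (f @^-1` B)
  by rewrite -[X in measurable X]setTI; exact: (mf measurableT _ mB).
rewrite [X in (_ * X)%E](_ : _ =
  (\int[uniform_prob ab]_x Pn (xsection (f @^-1` B) x))%E)//.
rewrite integral_uniform//; last first.
  exact: measurable_fun_xsection.
have -> : q0 + e - (q0 - e) = 2 * e by ring.
rewrite muleA -EFinM exprS mulrAC divff ?mul1r; last first.
  by rewrite mulf_neq0// gt_eqF.
(* The uniform law lives on a closed interval, the cube is open; endpoints are null. *)
rewrite integral_itv_bndoo; last first.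
  by apply: measurable_funTS; exact: measurable_fun_xsection.
rewrite /=.
rewrite -ge0_integralZl//; last 2 first.
  by apply: measurable_funTS; exact: measurable_fun_xsection.
  by rewrite lee_fin exprn_ge0// mulr_ge0// ltW.
rewrite [RHS]integral_mkcond; apply: eq_integral => x _.
rewrite patchE; case: ifPn => [|/negP]; rewrite inE /= in_itv /= => xq.
  rewrite -PnE; last exact: measurable_xsection.
  congr (lebesgue_rV _); apply/seteqP; split=> v /=.
    move=> [/(normr_row_mx_lt _ _ _ e0)[_ vq] Bv]; split=> //.
    by rewrite /xsection /= inE.
  rewrite /xsection /= inE => -[vq Bv]; split=> //.
  by apply/(normr_row_mx_lt _ _ _ e0); split=> //; rewrite ltr_distl.
(* The section is empty; this form lets [PnE] apply to it. *)
have -> : [set v | (sup_ball q e `&` B) (row_mx x%:M v)] =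
    sup_ball (@rsubmx _ _ 1 n q) e `&` set0.
  rewrite setI0; apply/seteqP; split=> v //=.
  move=> [/(normr_row_mx_lt _ _ _ e0)[xq' _] _].
  by apply: xq; rewrite -ltr_distl.
by rewrite PnE// measure0 mule0.
Qed.

(** * Insertion of points *)

Lemma measurable_add_point (R : realType) n d (T : measurableType d)
    (f : T -> measures 'rV[R]_n R) (g : T -> 'rV[R]_n) :
  measurable_fun setT f -> measurable_fun setT g ->
  measurable_fun setT (fun t => add_point (f t) (g t)).
Proof.
move=> mf mg; apply: measurable_fun_measures => A mA.
under eq_fun do rewrite add_pointE.
apply: emeasurable_funD.
  exact: (measurableT_comp (measurable_ev mA) mf).
apply: (measurableT_comp (f := fun x => \d_x A)) => //.
exact: measurable_fun_dirac.
Qed.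

Section insertion.
Context (R : realType) (n : nat) (d : measure_display) (T : measurableType d)
  (P : probability T R) (Pi : {RV P >-> measures 'rV[R]_n R}).
Hypotheses (Pi_pp : point_process Pi) (Pi_ins : insertion_tolerant Pi).
Implicit Types A : set (measures 'rV[R]_n R).

Lemma insertion_step (q : 'rV[R]_n) (e : R) A A' : 0 < e ->
  measurable A -> measurable A' ->
  (forall mu u, A mu -> sup_ball q e u -> A' (add_point mu u)) ->
  (0 < P (Pi @^-1` A))%E -> (0 < P (Pi @^-1` A'))%E.
Proof.
move=> e0 mA mA' AA' PA; rewrite lt0e measure_ge0 andbT; apply/eqP => PA'0.
have [P0 P0E] := uniform_sup_ball q e0.
pose S := sup_ball q e; pose c : R := (2 * e) ^+ n.
have c0 : 0 < c by rewrite exprn_gt0// mulr_gt0.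
have mS : measurable S by exact: measurable_sup_ball.
have lS : lebesgue_rV S = c%:E.
  by rewrite -[S]setIT P0E// probability_setT mule1.
have P0S : P0 S = 1%E.
  rewrite -[P0 S]mul1e -(mulVf (lt0r_neq0 c0)) EFinM -muleA -P0E// setIid -/S.
  by rewrite lS -EFinM mulVf// gt_eqF.
pose PP : probability (T * 'rV[R]_n)%type R := (P \x P0)%E.
have mPi : measurable_fun setT (Pi \o (@fst T 'rV[R]_n)).
  exact: measurableT_comp.
pose Pi' : {RV PP >-> measures 'rV[R]_n R} :=
  HB.pack (Pi \o (@fst T 'rV[R]_n)) (isMeasurableFun.Build _ _ _ _ _ mPi).
have mU : measurable_fun setT (@snd T 'rV[R]_n) by exact: measurable_snd.
pose U : {RV PP >-> 'rV[R]_n} :=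
  HB.pack (@snd T 'rV[R]_n) (isMeasurableFun.Build _ _ _ _ _ mU).
have PPX (B : set T) (C : set 'rV[R]_n) : measurable B -> measurable C ->
    PP (B `*` C) = (P B * P0 C)%E.
  exact: product_measure1E.
have PPPi B : measurable B -> PP (Pi' @^-1` B) = P (Pi @^-1` B).
  move=> mB; rewrite (_ : Pi' @^-1` B = (Pi @^-1` B) `*` setT).
    by rewrite PPX ?probability_setT ?mule1//; exact: measurable_funPTI.
  by apply/seteqP; split=> -[x y] //= [].
have PPU C : measurable C -> PP (U @^-1` C) = P0 C.
  move=> mC; rewrite (_ : U @^-1` C = setT `*` C).
    by rewrite PPX ?probability_setT ?mul1e.
  by apply/seteqP; split=> -[x y] //= [].
have lS0 : (0 < lebesgue_rV S)%E by rewrite lS lte_fin.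
have lSoo : (lebesgue_rV S < +oo)%E by rewrite lS ltry.
have pp' : point_process Pi' by move=> w; exact: Pi_pp.
have sl : same_law PP P Pi' Pi by move=> B mB; exact: PPPi.
have unif : uniform_on PP S U.
  move=> B mB; rewrite PPU// P0E// lS -/c.
  by rewrite muleAC inver gt_eqF// -EFinM divff ?mul1e// gt_eqF.
have ind : independent_rv PP Pi' U.
  move=> B C mB mC; rewrite PPPi// PPU//.
  rewrite (_ : _ `&` _ = (Pi @^-1` B) `*` C).
    by rewrite PPX//; exact: measurable_funPTI.
  by apply/seteqP; split=> -[x y].
have := Pi_ins mS lS0 lSoo pp' sl unif ind mA' PA'0.
set E := (X in PP X = _) => PE0.
have : (PP (Pi @^-1` A `*` S) <= PP E)%E.
  apply: le_measure; rewrite ?inE.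
  - by apply: measurableX => //; exact: measurable_funPTI.
  - rewrite -[X in measurable X]setTI /E.
    by apply: (measurable_add_point mPi mU) => //.
  - by move=> [w u] /= [Aw Su]; exact: AA'.
by rewrite PE0 PPX ?P0S ?mule1//; [rewrite leNgt PA|exact: measurable_funPTI].
Qed.

(** One insertion per ball: later points cannot discharge balls already charged. *)
Lemma insertion_fill (m : R) A (L : seq ('rV[R]_n * R)) :
  (forall qe, qe \in L ->
    0 < qe.2 /\ sup_ball qe.1 qe.2 `<=` [set x | `|x| <= m]) ->
  measurable A ->
  (forall mu u, `|u| <= m -> A mu -> A (add_point mu u)) ->
  (0 < P (Pi @^-1` A))%E ->
  let A' := [set mu | A mu /\
    forall qe, qe \in L -> (0 < mu (sup_ball qe.1 qe.2))%E] in
  measurable A' /\ (0 < P (Pi @^-1` A'))%E.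
Proof.
elim: L => [|qe L IH] hL mA Aadd PA.
  by rewrite (_ : [set mu | _] = A)//; apply/seteqP; split=> mu //= [].
have [|mB PB] := IH _ mA Aadd PA.
  by move=> qe' qe'L; apply: hL; rewrite inE qe'L orbT.
have [qe0 qem] := hL qe (mem_head _ _).
set B := (X in measurable X) in mB; rewrite -/B in PB.
rewrite /= (_ : [set mu | _] = B `&` [set mu : measures 'rV[R]_n R |
    (0 < mu (sup_ball qe.1 qe.2))%E]); last first.
  apply/seteqP; split=> mu /=.
    move=> [Amu h]; split; last by apply: h; rewrite mem_head.
    by split=> // qe' qe'L; apply: h; rewrite inE qe'L orbT.
  move=> [[Amu h] h0]; split=> // qe'; rewrite inE => /predU1P[->//|].
  exact: h.
have mB' : measurable (B `&` [set mu : measures 'rV[R]_n R |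
    (0 < mu (sup_ball qe.1 qe.2))%E]).
  apply: measurableI => //; apply: measurable_charged.
  exact: measurable_sup_ball.
split=> //.
apply: (@insertion_step qe.1 qe.2 B _ qe0 mB mB' _ PB) => mu u [Amu h] qu.
have inc C : (mu C <= add_point mu u C)%E by rewrite add_pointE leeDl.
split=> /=; last first.
  rewrite add_pointE diracE mem_set//.
  by apply: (@lt_le_trans _ _ 1%E); [exact: lte01|exact: leeDr].
split; first by apply: Aadd => //; exact: qem.
by move=> qe' /h /lt_le_trans; apply.
Qed.

End insertion.

(** * Configurations *)

Lemma bounded_norm_le (R : realType) n (m : R) :
  bounded_set [set x : 'rV[R]_n | `|x| <= m].
Proof.
by exists m; split=> [|M mM x /le_trans]; [exact: num_real|apply; exact: ltW].
Qed.

(** The balls must lie inside the cube, so the finite subcover uses centers in the open cube and the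
    radii are then cut down. *)
Lemma finite_net (R : realType) n (m eta : R) : 0 < m -> 0 < eta ->
  exists L : seq ('rV[R]_n * R),
    (forall qe, qe \in L ->
      0 < qe.2 /\ sup_ball qe.1 qe.2 `<=` [set x | `|x| <= m]) /\
    forall X : set 'rV[R]_n,
      (forall qe, qe \in L -> X `&` sup_ball qe.1 qe.2 !=set0) ->
      dense_in X m eta.
Proof.
move=> m0 eta0; pose K := [set x : 'rV[R]_n | `|x| <= m].
have cK : compact K.
  apply: bounded_closed_compact.
    exact: bounded_norm_le.
  rewrite -[K]setCK; apply: open_closedC; exact: open_out.
have eta2 : 0 < eta / 2 by rewrite divr_gt0.
move: cK; rewrite compact_cover => /(_ _ [set q : 'rV[R]_n | `|q| < m]
  (fun q => sup_ball q (eta / 2))) [|y ym|D' D'm KD'].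
- by move=> q _; exact: sup_ball_open.
(* Shrinking [y] by [1 - t] enters the open cube and moves it by less than [eta / 2]. *)
- pose t := eta / 2 / (m + eta / 2).
  have me : 0 < m + eta / 2 by rewrite addr_gt0.
  have t0 : 0 < t by rewrite divr_gt0.
  have t1 : t <= 1 by rewrite ler_pdivrMr// mul1r lerDr ltW.
  have tm : t * m < eta / 2.
    by rewrite /t mulrAC ltr_pdivrMr// ltr_pM2l// ltrDl.
  exists ((1 - t) *: y) => /=.
    rewrite normrZ ger0_norm ?subr_ge0//.
    apply: (@le_lt_trans _ _ ((1 - t) * m)).
      by rewrite ler_wpM2l// subr_ge0.
    by rewrite mulrBl mul1r gtrBl mulr_gt0.
  rewrite /sup_ball /= scalerBl scale1r opprB addrC subrK normrZ gtr0_norm//.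
  by apply: le_lt_trans tm; rewrite ler_wpM2l// ltW.
exists [seq (q, Num.min (eta / 2) (m - `|q|)) | q <- enum_fset D'];
  split.
  move=> _ /mapP[q qD ->] /=.
  have qm : `|q| < m by have := D'm _ qD; rewrite inE.
  split; first by rewrite lt_min eta2 subr_gt0.
  move=> x; rewrite /sup_ball /= lt_min => /andP[_]; rewrite ltrBrDr => /ltW.
  apply: le_trans; rewrite -{1}[x](subrK q); exact: ler_normD.
move=> X XL y /KD'[q qD yq].
have [|p [Xp]] := XL (q, Num.min (eta / 2) (m - `|q|)).
  by apply/mapP; exists q.
rewrite /sup_ball /= lt_min => /andP[p1 p2]; exists p; split=> //.
  move: p2; rewrite ltrBrDr => /ltW; apply: le_trans.
  rewrite -{1}[p](subrK q); exact: ler_normD.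
have -> : p - y = (p - q) + (q - y) by rewrite addrA subrK.
apply: le_lt_trans (ler_normD _ _) _.
move: yq; rewrite /sup_ball /= distrC => yq.
by rewrite [ltRHS]splitr ltrD.
Qed.

Section configurations_facts.
Variables (R : realType) (n : nat).
Local Notation V := 'rV[R]_n.
Local Notation M := (measures 'rV[R]_n R).
Implicit Types (mu : M) (x y t : V).

Lemma measurable_set1_rV x : measurable [set x].
Proof.
rewrite -[[set x]]setCK; apply: measurableC; apply: open_measurable_mx.
apply: open_norm_rV => y yx; exists `|y - x|.
  by rewrite normr_gt0 subr_eq0; apply/eqP.
by move=> z + zx; rewrite zx distrC ltxx.
Qed.

(** A sum of Dirac masses charges a set only through an atom in it, and simplicity fixes the mass of
    the atom at 1. *)
Lemma charges_configuration mu :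
  configurations mu -> charges mu (mu_support mu).
Proof.
move=> [[D [x muE]] mu1 _] U oU; have mU := open_measurable_mx oU.
split=> [muU|[y [y1 Uy]]]; last first.
  apply: (@lt_le_trans _ _ (mu [set y])); first by rewrite y1 lte01.
  apply: le_measure; rewrite ?inE//; first exact: measurable_set1_rV.
  by move=> _ ->.
have [k Dk Uxk] : exists2 k, D k & U (x k).
  apply: contrapT => /forall2NP h; move: muU; rewrite muE// esum1 ?ltxx//.
  by move=> k Dk; rewrite diracE memNset//; have [] := h k.
exists (x k); split=> //; apply/eqP; rewrite eq_le mu1 /=.
rewrite muE; last exact: measurable_set1_rV.
apply: esum_ge; exists [set k]; first by split=> // _ ->.
by rewrite fsbig_set1 diracE mem_set.
Qed.

Lemma finite_mu_support mu (b : R) : configurations mu ->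
  finite_set (mu_support mu `&` [set x | `|x| <= b]).
Proof.
move=> [_ _ lf]; apply: contrapT => infX; set B := [set x : V | `|x| <= b].
have mB : measurable B.
  rewrite -[B]setCK; apply: measurableC; apply: open_measurable_mx.
  exact: open_out.
have bB : bounded_set B.
  exact: bounded_norm_le.
have muB := lf B mB bB.
have [r rE] : exists r, mu B = r%:E.
  by exists (fine (mu B)); rewrite fineK// ge0_fin_numE.
have [F FX FN] := infinite_set_fset (Num.truncn r).+1 infX.
have F1 : \bigcup_(y in [set` F]) [set y] = [set` F].
  by rewrite bigcup_imset1 image_id.
have mF : measurable [set` F].
  rewrite -F1; apply: fin_bigcup_measurable; first exact: finite_fset.
  by move=> y _; exact: measurable_set1_rV.
have : (mu [set` F] <= mu B)%E.
  by apply: le_measure; rewrite ?inE// => y /FX[].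
rewrite -F1 measure_fin_bigcup//; last 2 first.
- by apply/trivIsetP => y z _ _ /eqP yz; apply/seteqP; split=> u //= [-> /yz].
- by move=> y _; exact: measurable_set1_rV.
rewrite (eq_fsbigr (fun=> 1%E)); last by move=> y; rewrite inE => /FX[].
rewrite fsbig_finite ?set_fsetK//= big_const_seq count_predT.
rewrite rE leNgt => /negP; apply.
have -> : forall k, iter k (adde 1%E) 0%E = k%:R%:E :> \bar R.
  by elim=> //= k ->; rewrite -[k.+1]add1n natrD EFinD.
rewrite lte_fin (lt_le_trans (truncnS_gt r))// ler_nat; exact: FN.
Qed.
End configurations_facts.

(** * Translated configurations *)

Section translates.
Variables (R : realType) (n : nat).
Local Notation V := 'rV[R]_n.
Local Notation M := (measures 'rV[R]_n R).
Implicit Types (mu : M) (t x y : V) (X : set V).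

Lemma open_shift t (U : set V) : open U -> open [set x | U (x + t)].
Proof.
move=> oU; apply: open_norm_rV => x /(open_norm_rVP oU)[e e0 eU].
exists e => // y yx; apply: eU; by rewrite opprD addrACA subrr addr0.
Qed.

Lemma charges_translate t mu X :
  charges mu X -> charges (translate t mu) [set x | X (x - t)].
Proof.
move=> muX U oU; have -> : translate t mu U = mu [set x | U (x + t)] by [].
apply: (iff_trans (muX _ (open_shift (t := t) oU))).
split=> -[x [Xx Ux]].
  by exists (x + t); split=> //=; rewrite addrK.
by exists (x - t); split=> //=; rewrite subrK.
Qed.

Lemma measurable_translate t : measurable_fun setT (translate t : M -> M).
Proof.
apply: measurable_fun_measures => A mA.
apply: (@measurable_ev _ _ _ [set x : V | A (x + t)]).
rewrite -[X in measurable X]setTI.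
apply: (continuous_measurable_mx (f := fun x : V => x + t)) => //.
move=> x; have ct : {for x, continuous (fun=> t)} by exact: cst_continuous.
have cid : {for x, continuous (fun y : V => y)} by [].
exact: (continuousD cid ct).
Qed.

Lemma two_event_translate rho t mu : 0 < rho -> configurations mu ->
  two_event rho (translate t mu) <-> two_event rho mu.
Proof.
move=> rho0 /charges_configuration muX.
have tX := charges_translate t muX.
rewrite (two_eventP rho0 tX) (two_eventP rho0 muX); split.
  apply: (@two_unbounded_shift _ _ _ _ _ (- t)) => z //=.
  by rewrite opprK addrK.
apply: (@two_unbounded_shift _ _ _ _ _ t) => z //=.
by rewrite addrK.
Qed.

End translates.

Lemma trifurcation_event_eq0 (R : realType) (n : nat) d (T : measurableType d)
    (P : probability T R) (Pi : {RV P >-> measures 'rV[R]_n.+1 R}) (rho m : R)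
    (A : set (measures 'rV[R]_n.+1 R)) : 0 < rho -> 0 <= m ->
  point_process Pi -> translation_invariant Pi -> measurable A ->
  (forall mu z, configurations mu -> A (translate (- z) mu) ->
    trifurcation rho (mu_support mu) z m) ->
  P (Pi @^-1` A) = 0%E.
Proof.
move=> rho0 m0 pp inv mA Atri; apply/eqP/negPn/negP => PA0.
have PAfin : P (Pi @^-1` A) \is a fin_num.
  by rewrite fin_num_measure//; exact: measurable_funPTI.
pose p := fine (P (Pi @^-1` A)).
have pE : P (Pi @^-1` A) = p%:E by rewrite fineK.
have p0 : 0 < p by rewrite -lte_fin -pE lt0e PA0 measure_ge0.
have [C Cle] : exists C : nat, forall K (X : set 'rV[R]_n.+1)
    (Z : {set {ffun 'I_n.+1 -> 'I_K}}), (0 < K)%N ->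
    (forall a, a \in Z -> trifurcation rho X (grid_center rho m a) m) ->
    (#|Z| <= C * K ^ n)%N.
  by eexists => K X Z K0 tri; exact: (card_trifurcation_le rho0 m0 K0 tri).
(* Large enough that the expected number [p * K ^ n.+1] exceeds the bound [C * K ^ n]. *)
pose K := (Num.truncn (C%:R / p)).+1.
pose I := {ffun 'I_n.+1 -> 'I_K}.
pose E (a : I) := (translate (- grid_center rho m a) \o Pi) @^-1` A.
have mE a : measurable (E a).
  rewrite -[X in measurable X]setTI; apply: measurableT_comp => //.
  exact: measurable_translate.
have PE a : P (E a) = p%:E by rewrite -pE; exact: inv.
have intE a : (\int[P]_x (\1_(E a) x)%:E = p%:E)%E.
  by rewrite integral_indic// setIT; exact: PE.
have : (\int[P]_w (\sum_(a <- index_enum I) (\1_(E a) w)%:E) <=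
    \int[P]_w (cst (C * K ^ n)%:R%:E w))%E.
  apply: ge0_le_integral => //.
  - by move=> w _; apply: sume_ge0 => a _; rewrite lee_fin.
  - apply: emeasurable_sum => a.
    by apply/measurable_EFinP; exact: measurable_indic.
  - move=> w _ /=; rewrite sumEFin lee_fin.
    pose Z := [set a : I | w \in E a]%SET.
    rewrite (_ : \sum_(a <- _) _ = #|Z|%:R).
      rewrite ler_nat; apply: (Cle K (mu_support (Pi w))) => // a.
      by rewrite !inE => Ea; apply: Atri.
    rewrite -sum1_card natr_sum [RHS]big_mkcond /=.
    by apply: eq_bigr => a _; rewrite indicE inE; case: (w \in E a).
rewrite integral_cst//.
rewrite [X in (_ <= _ * X)%E](_ : _ = 1%E) ?mule1; last exact: probability_setT.
rewrite ge0_integral_sum//; last first.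
  by move=> a; apply/measurable_EFinP; exact: measurable_indic.
under eq_bigr => a _ do rewrite intE.
rewrite sumEFin lee_fin sumr_const card_ffun !card_ord.
rewrite expnS natrM -[p *+ _]mulr_natr natrM mulrA ler_pM2r; last first.
  by rewrite ltr0n expn_gt0.
apply/negP; rewrite -ltNge mulrC -ltr_pdivrMr//; exact: truncnS_gt.
Qed.

(** * Clusters *)

Lemma open_disjoint_separated (T : topologicalType) (A B : set T) :
  open A -> open B -> A `&` B = set0 -> separated A B.
Proof.
move=> oA oB AB; split; apply/seteqP; split=> // u.
- move=> [clA Bu]; have [w wAB] := clA _ (open_nbhs_nbhs (conj oB Bu)).
  by move: wAB; rewrite AB.
- move=> [Au clB]; have [w [Bw Aw]] := clB _ (open_nbhs_nbhs (conj oA Au)).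
  by have : (A `&` B) w by []; rewrite AB.
Qed.

Section clusters.
Variables (R : realType) (n : nat) (r : R).
Hypothesis r_gt0 : 0 < r.
Local Notation V := 'rV[R]_n.
Local Notation adj := (@adj R n (2 * r)).
Variable mu : measures V R.
Local Notation X := (mu_support mu).
Local Notation O := (occupied_region r mu).
Implicit Types (x y z : V) (C : set V).

Lemma connected_component_segment (A : set V) x y :
  (forall t : R, 0 <= t <= 1 -> A (x + t *: (y - x))) ->
  connected_component A x y.
Proof.
move=> h; pose f (t : R) : V := x + t *: (y - x).
apply: (@connected_component_max _ _ (f @` `[0, 1])).
- by exists 0; rewrite /f ?scale0r ?addr0//= in_itv /= lexx ler01.
- by move=> _ [t /= + <-]; rewrite in_itv => /h.
- apply: connected_continuous_connected; first exact: segment_connected.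
  apply: continuous_subspaceT => t; apply: cvgD; first exact: cvg_cst.
  by apply: cvgZr_tmp; exact: cvg_id.
by exists 1; rewrite /f ?scale1r ?(addrC x) ?subrK//= in_itv /= lexx ler01.
Qed.

Lemma occupied_ball_component x y :
  X x -> euclidean_norm (x - y) < r -> connected_component O x y.
Proof.
move=> Xx xy; apply: connected_component_segment => t /andP[t0 t1].
exists x => //; rewrite /euclidean_ball /= opprD addrA subrr add0r.
rewrite -scalerN opprB euclidean_normZ ger0_norm//.
by apply: le_lt_trans xy; rewrite ler_piMl// euclidean_norm_ge0.
Qed.

Lemma reach_component x y : reach adj X x y -> connected_component O x y.
Proof.
elim=> [Xx|y1 y2 r1 IH Xy2 ey].
  by apply: occupied_ball_component => //; rewrite subrr euclidean_norm0.
apply: (connected_component_trans IH).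
(* The midpoint lies in both balls. *)
pose w := y1 + 2^-1 *: (y2 - y1).
have half : 2^-1 * euclidean_norm (y1 - y2) < r.
  by rewrite mulrC ltr_pdivrMr// mulrC.
apply: (@connected_component_trans _ _ w).
  apply: occupied_ball_component; first exact: reachr r1.
  rewrite (_ : y1 - w = 2^-1 *: (y1 - y2)); last first.
    by apply/rowP => i; rewrite !mxE; ring.
  by rewrite euclidean_normZ gtr0_norm ?invr_gt0.
apply: connected_component_sym; apply: occupied_ball_component => //.
rewrite (_ : y2 - w = 2^-1 *: (y2 - y1)); last first.
  by apply/rowP => i; rewrite !mxE; field.
by rewrite euclidean_normZ gtr0_norm ?invr_gt0// euclidean_distC.
Qed.

(** The balls of one graph component and those of the others form disjoint open sets, so the
    connected [C] lies in the former and is bounded if the graph component is. *)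
Lemma unbounded_cluster_reach C : unbounded_clusters r mu C ->
  exists2 x, unbounded_reach adj X x & C = connected_component O x.
Proof.
move=> [[y [x Xx xy] CE] nbC].
have cxy := occupied_ball_component Xx xy.
exists x; last by rewrite -CE -(same_connected_component cxy).
split=> // j; apply: contrapT => /forall2NP nj; apply: nbC.
have {}nj z : reach adj X x z -> `|z| <= j%:R.
  by move=> xz; have [//|/negP] := nj z; rewrite -leNgt.
pose G := \bigcup_(z in [set z | reach adj X x z]) euclidean_ball z r.
pose G' := \bigcup_(z in [set z | X z /\ ~ reach adj X x z]) euclidean_ball z r.
have oG (Q : set V) : open (\bigcup_(z in Q) euclidean_ball z r).
  by apply: bigcup_open => z _; exact: open_euclidean_ball.
have GG' : G `&` G' = set0.
  apply/seteqP; split=> // u [[z xz zu] [z' [Xz' nz'] z'u]]; apply: nz'.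
  apply: (reach_step xz Xz'); rewrite /adj.
  apply: le_lt_trans (euclidean_dist_triangle u _ _) _.
  by rewrite mulr_natl mulr2n ltrD// euclidean_distC.
have CO : C `<=` G `|` G'.
  rewrite -CE => u /connected_component_sub[z Xz zu].
  have [xz|nz] := pselect (reach adj X x z); first by left; exists z.
  by right; exists z; first by split.
have cC : connected C by rewrite -CE; exact: component_connected.
have sG := open_disjoint_separated (oG _) (oG _) GG'.
have Cy : C y by rewrite -CE; apply: connected_component_refl; exists x.
have Gy : G y by exists x => //; exact: reach_refl.
have [CG|CG'] := connected_subset sG CO cC; last first.
  have : (G `&` G') y by split=> //; exact: CG'.
  by rewrite GG'.
exists (j%:R + r); split; first exact: num_real.
move=> M jM u /CG[z /nj zj zu].
apply: ltW; apply: le_lt_trans jM.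
rewrite -[u](subrK z) addrC (le_trans (ler_normD _ _))// lerD// distrC.
by rewrite (le_trans (normr_le_euclidean_norm _))// ltW.
Qed.

Lemma not_two_unbounded_subset1 :
  ~ two_unbounded (2 * r) X -> is_subset1 (unbounded_clusters r mu).
Proof.
move=> n2 C1 C2 /unbounded_cluster_reach[x1 u1 ->].
move=> /unbounded_cluster_reach[x2 u2 ->].
apply: same_connected_component; apply: reach_component.
by apply: contrapT => nr; apply: n2; exists x1, x2.
Qed.

End clusters.

(** * Uniqueness *)

Section merge.
Context (R : realType) (n : nat) (d : measure_display) (T : measurableType d)
  (P : probability T R) (Pi : {RV P >-> measures 'rV[R]_n R}).
Hypotheses (Pi_pp : point_process Pi) (Pi_ins : insertion_tolerant Pi).
Variable rho : R.
Hypothesis rho_gt0 : 0 < rho.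
Implicit Types A : set (measures 'rV[R]_n R).

(** Density is asserted for any charged [X], so it also applies to translates. *)
Lemma fill_dense (m eta : R) A : 0 < m -> 0 < eta -> measurable A ->
  (forall mu u, `|u| <= m -> A mu -> A (add_point mu u)) ->
  (0 < P (Pi @^-1` A))%E ->
  exists A', [/\ measurable A', (0 < P (Pi @^-1` A'))%E, A' `<=` A &
    forall mu X, charges mu X -> A' mu -> dense_in X m eta].
Proof.
move=> m0 eta0 mA Aadd PA.
have [L [hL Ldense]] := @finite_net R n m eta m0 eta0.
have [mA' PA'] := insertion_fill Pi_pp Pi_ins hL mA Aadd PA.
eexists; split; [exact: mA'|exact: PA'|by move=> mu []|].
move=> mu X muX [_ h]; apply: Ldense => qe /h.
by move=> /(muX _ (@sup_ball_open R n qe.1 qe.2)).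
Qed.

Lemma exists_mesh (k : nat) : exists eta : R,
  [/\ 0 < eta, 4 * eta <= rho / n.+1%:R & slack rho k + n.+1%:R * eta <= rho].
Proof.
exists (Num.min (rho / n.+1%:R / 4) (k.+1%:R^-1 / n.+1%:R)); split.
- by rewrite lt_min !divr_gt0.
- by rewrite mulrC -ler_pdivlMr// ge_min lexx.
- rewrite /slack addrAC -lerBrDr opprK lerD2l mulrC -ler_pdivlMr//.
  by rewrite ge_min lexx orbT.
Qed.

Lemma all_near_event_eq0 (m k : nat) :
  P (Pi @^-1` two_event rho) = 1%E ->
  P (Pi @^-1` all_near_event rho m.+1%:R (slack rho k)) = 0%E.
Proof.
move=> P1; apply/eqP/negPn/negP => PA.
have [eta [eta0 eta1 eta2]] := exists_mesh k.
have [A' [mA' PA' A'A A'dense]] := @fill_dense m.+1%:R eta _ (ltr0Sn _ _) eta0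
  (measurable_all_near_event _ _ _)
  (fun mu u => @all_near_event_add_point R n rho mu m.+1%:R (slack rho k) u)
  ltac:(by rewrite lt0e PA measure_ge0).
(* Once filled, a configuration has no two unbounded components, which excludes the almost sure
   event. *)
have : (P (Pi @^-1` A') <= P (~` (Pi @^-1` two_event rho)))%E.
  apply: le_measure; rewrite ?inE; [exact: measurable_funPTI| |].
    apply: measurableC; apply: measurable_funPTI.
    exact: measurable_two_event.
  move=> w /= A'w; have muX := charges_configuration (Pi_pp w).
  move=> /(two_eventP rho_gt0 muX).
  apply: (@all_near_dense _ _ _ _ m.+1%:R (slack rho k) eta) => //.
    by apply/(all_near_eventP rho_gt0 _ _ muX); exact: A'A.
  exact: A'dense A'w.
rewrite probability_setC; last first.
  by apply: measurable_funPTI; exact: measurable_two_event.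
by rewrite P1 subee// leNgt PA'.
Qed.

Lemma three_near_event_gt0 : P (Pi @^-1` two_event rho) = 1%E ->
  exists m k : nat,
    (0 < P (Pi @^-1` three_near_event rho m.+1%:R (slack rho k)))%E.
Proof.
move=> P1; apply: contrapT => no.
have three0 m k :
    P (Pi @^-1` three_near_event rho m.+1%:R (slack rho k)) = 0%E.
  apply: contrapT => /eqP h; apply: no; exists m, k.
  by rewrite lt0e h measure_ge0.
have null m k : P.-negligible
    (Pi @^-1` (all_near_event rho m.+1%:R (slack rho k) `|`
      three_near_event rho m.+1%:R (slack rho k))).
  rewrite preimage_setU; apply: negligibleU.
    exists (Pi @^-1` all_near_event rho m.+1%:R (slack rho k)); split=> //.
      by apply: measurable_funPTI; exact: measurable_all_near_event.
    exact: all_near_event_eq0.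
  exists (Pi @^-1` three_near_event rho m.+1%:R (slack rho k)); split=> //.
    by apply: measurable_funPTI; exact: measurable_three_near_event.
  exact: three0.
(* The countably many events cover the probability space, so they cannot all be null. *)
have /negligibleP : P.-negligible [set: T].
  have := negligible_bigcup (fun m => negligible_bigcup (null m)).
  apply: negligibleS => w _; have muX := charges_configuration (Pi_pp w).
  have [|m [k mk]] := @all_or_three_near _ _ rho (mu_support (Pi w)).
    by move=> b; exact: finite_mu_support (Pi_pp w).
  exists m => //; exists k => //=; case: mk => h; [left|right].
    exact/(all_near_eventP rho_gt0 _ _ muX).
  exact/(three_near_eventP rho_gt0 _ _ muX).
move=> /(_ measurableT) PT0.
have := probability_setT P; rewrite [LHS]PT0 => /eqP.
by rewrite eq_sym onee_eq0.
Qed.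

End merge.

Theorem theorem6 (R : realType) (n : nat)
    (d : measure_display) (T : measurableType d) (P : probability T R)
    (Pi : {RV P >-> measures 'rV[R]_n R})
    (Pi_pp : point_process Pi)
    (Pi_inv : translation_invariant Pi)
    (Pi_erg : ergodic Pi)
    (Pi_ins : insertion_tolerant Pi)
    (r : R) (r_gt0 : 0 < r) :
  {ae P, forall w, is_subset1 (unbounded_clusters r (Pi w))}.
Proof.
have rho_gt0 : 0 < 2 * r by rewrite mulr_gt0.
(* In dimension 0 the space is one point and nothing is unbounded; the counting needs a positive
   dimension. *)
case: n Pi Pi_pp Pi_inv Pi_erg Pi_ins => [|n] Pi Pi_pp Pi_inv Pi_erg Pi_ins.
  apply: aeW => w C1 C2 [_ nb]; exfalso; apply: nb.
  exists 0; split; first exact: num_real.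
  move=> M M0 x _; have -> : x = 0 by apply/rowP => -[].
  by rewrite /= normr0 ltW.
have mE : measurable (Pi @^-1` two_event (2 * r)).
  by apply: measurable_funPTI; exact: measurable_two_event.
suff PE : P (Pi @^-1` two_event (2 * r)) = 0%E.
  exists (Pi @^-1` two_event (2 * r)); split=> // w nw.
  have muX := charges_configuration (Pi_pp w).
  apply/(two_eventP rho_gt0 muX); apply: contrapT => n2; apply: nw.
  exact: not_two_unbounded_subset1.
have [||//|P1] := Pi_erg.2 (two_event (2 * r)).
- exact: measurable_two_event.
- by move=> t mu; exact: two_event_translate.
have [m [k Pmk]] := three_near_event_gt0 Pi_pp Pi_ins rho_gt0 P1.
have [eta [eta0 eta1 eta2]] := exists_mesh n.+1 rho_gt0 k.
have [A' [mA' PA' A'A A'dense]] := fill_dense Pi_pp Pi_ins (ltr0Sn _ m) eta0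
  (measurable_three_near_event _ _ _)
  (fun mu u =>
    @three_near_event_add_point R n.+1 (2 * r) mu m.+1%:R (slack (2 * r) k) u)
  Pmk.
suff : P (Pi @^-1` A') = 0%E by move=> PA'0; rewrite PA'0 ltxx in PA'.
apply: (@trifurcation_event_eq0 _ _ _ _ _ _ (2 * r) m.+1%:R) => //.
(* [A'] is known for the configuration recentered at [z], so density and nearness are read off the
   shifted support. *)
move=> mu z /charges_configuration/(charges_translate (- z)) muX A'mu.
apply: (three_near_trifurcation _ _ _ (A'dense _ _ muX A'mu) eta1 eta2) => //.
- by move=> x /=; rewrite opprK.
- by apply/(three_near_eventP rho_gt0 _ _ muX); exact: A'A.
Qed.
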